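(* Let $d=2n-1>3$ and let $f\in\mathbb{C}[x_1,\ldots,x_n,u,v]_{d+2}$ be the (exceptional) form of degree $d+2$ given by $$f=x_1u^dv+x_2u^{d-2}v^3+\cdots+x_nuv^d+h,\qquad h=\sum_{i=1}^{\binom{n+1}{2}}l_i^{d+2}\in\mathbb{C}[x_1,\ldots,x_n],$$ where the $l_i\in\mathbb{C}[x_1,\ldots,x_n]_1$ are generic linear forms. Then $f$ is wild.
   Context: The $i$-th term of the first part of $f$ is $x_iu^{d-2(i-1)}v^{2i-1}$, $i=1,\ldots,n$. ''Generic'' means that the tuple of linear forms $(l_i)$ lies in a suitable non-empty Zariski open set. For a form $f$ of degree $D$ in a polynomial ring $R$ over $\mathbb{C}$, let $X=\{[\ell^D]:\ell\in R_1\setminus\{0\}\}\subset\mathbb{P}(R_D)$ be the Veronese variety. The border rank $\underline{rk}(f)$ is the least $s$ such that $[f]$ lies in the $s$-th secant variety of $X$ (the closure of the union of the spans of $s$ points of $X$). The smoothable rank $sr(f)$ is the least $s$ such that there is a smoothable finite scheme $K\subset X$ of length $s$ with $[f]\in\langle K\rangle$ (linear span). The form $f$ is wild if $\underline{rk}(f)<sr(f)$. *)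

(* Defs.v *)
From HB Require Import structures.
From mathcomp Require Import all_boot all_order all_algebra all_field.
From mathcomp Require Import complex mpoly reals.
Set Implicit Arguments.
Unset Strict Implicit.
Unset Printing Implicit Defensive.
Import GRing.Theory.
Local Open Scope ring_scope.

(* A point of the projective space P^(N-1) is represented by any nonzero     *)
(* row vector of homogeneous coordinates.                                    *)

Definition evalr (C : fieldType) (N : nat) (P : {mpoly C[N]}) (x : 'rV[C]_N) : C :=
  P.@[fun k => x 0 k].

Definition zariski_closed (C : fieldType) (N : nat) (Z : 'rV[C]_N -> Prop) : Prop :=
  exists I : {mpoly C[N]} -> Prop,
    forall x, Z x <-> (forall P, I P -> evalr P x = 0).

Definition zariski_open (C : fieldType) (N : nat) (U : 'rV[C]_N -> Prop) : Prop :=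
  zariski_closed (fun x => ~ U x).

Definition proj_closure (C : fieldType) (N : nat) (S : 'rV[C]_N -> Prop)
    (x : 'rV[C]_N) : Prop :=
  forall (k : nat) (G : {mpoly C[N]}), G \is k.-homog ->
    (forall y, y != 0 -> S y -> evalr G y = 0) -> evalr G x = 0.

(* Monomials of degree D in m variables; they index the coordinates of R_D,  *)
(* where R = C[X_1, ..., X_m].                                               *)
Definition mon (m D : nat) := {t : 'X_{1..m < D.+1} | mdeg t == D}.

Definition dimR (m D : nat) : nat := #|{: mon m D}|.

Definition fcoef (C : fieldType) (m D : nat) (f : {mpoly C[m]}) :
    'rV[C]_(dimR m D) :=
  \row_k f@_(val (val (enum_val k : mon m D))).

Definition veronese (C : fieldType) (m D : nat) (y : 'rV[C]_(dimR m D)) : Prop :=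
  exists l : {mpoly C[m]}, [/\ l \is 1.-homog, l != 0 & y = fcoef D (l ^+ D)].

Definition secant_union (C : fieldType) (m D s : nat) (y : 'rV[C]_(dimR m D)) : Prop :=
  exists (p : 'I_s -> 'rV[C]_(dimR m D)) (c : 'I_s -> C),
    (forall i, veronese (p i)) /\ y = \sum_i c i *: p i.

Definition in_secant (C : fieldType) (m D : nat) (f : {mpoly C[m]}) (s : nat) : Prop :=
  proj_closure (@secant_union C m D s) (fcoef D f).

Definition is_least (P : nat -> Prop) (s : nat) : Prop :=
  P s /\ forall t, P t -> (s <= t)%N.

Definition is_border_rank (C : fieldType) (m D : nat) (f : {mpoly C[m]}) : nat -> Prop :=
  is_least (in_secant D f).

Definition free_basis (B : nzRingType) (M : lmodType B) (s : nat) (e : 'I_s -> M) : Prop :=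
  bijective (fun c : {ffun 'I_s -> B} => \sum_i c i *: e i).

Definition evalA (C : fieldType) (A : comAlgType C) (N : nat) (a : 'I_N -> A)
    (G : {mpoly C[N]}) : A :=
  mmap (in_alg A) a G.

(* A (nonempty) finite subscheme K = Spec A of P^(N-1). Since K is finite    *)
(* and C is infinite, K lies in an affine chart {lam != 0} for some linear   *)
(* form lam. The embedding is given by the homogeneous coordinates of the    *)
(* tautological A-point, normalised by lam = 1; it is a closed immersion     *)
(* when these coordinates generate A as a C-algebra.                         *)
Record finite_subscheme (C : fieldType) (N : nat) := FiniteSubscheme {
  coord_ring : comAlgType C;
  hcoord : 'I_N -> coord_ring;
  finite_coord_ring : exists s, exists e : 'I_s -> coord_ring, free_basis e;
  chart : exists lam : 'I_N -> C, \sum_k lam k *: hcoord k = 1;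
  closed_immersion : forall y, exists G : {mpoly C[N]}, evalA hcoord G = y
}.

Definition scheme_length (C : fieldType) (N : nat) (K : finite_subscheme C N)
    (s : nat) : Prop :=
  exists e : 'I_s -> coord_ring K, free_basis e.

(* Containment of schemes: the homogeneous ideal of the (reduced) closed     *)
(* subset S vanishes on K.                                                   *)
Definition subscheme_of (C : fieldType) (N : nat) (K : finite_subscheme C N)
    (S : 'rV[C]_N -> Prop) : Prop :=
  forall (k : nat) (G : {mpoly C[N]}), G \is k.-homog ->
    (forall y, S y -> evalr G y = 0) -> evalA (@hcoord C N K) G = 0.

(* The linear span of K is cut out by the linear forms vanishing on the      *)
(* scheme K.                                                                 *)
Definition in_linear_span (C : fieldType) (N : nat) (K : finite_subscheme C N)
    (x : 'rV[C]_N) : Prop :=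
  forall lam : 'I_N -> C,
    \sum_k lam k *: @hcoord C N K k = 0 -> \sum_k lam k * x 0 k = 0.

(* F is a finite flat algebra over a C-domain B (hence a finite flat family  *)
(* over the irreducible base Spec B), whose geometric generic fibre is       *)
(* smooth, i.e. F (x)_B Omega is isomorphic, via the chi_i, to Omega^s. As   *)
(* finite flat families are locally free, Spec B is taken small enough for F *)
(* to be free.                                                               *)
Definition generically_smooth (B : idomainType) (F : comAlgType B) (s : nat)
    (e : 'I_s -> F) : Prop :=
  exists (Omega : closedFieldType) (j : {rmorphism B -> Omega})
         (chi : 'I_s -> {rmorphism F -> Omega}),
    [/\ injective j,
        forall i b x, chi i (b *: x) = j b * chi i x
      & (\matrix_(i, k) chi i (e k)) \in unitmx].

(* Spec A is smoothable: it is the fibre over a C-point b0 of such a family. *)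
(* The map pr identifies F (x)_B C with A.                                   *)
Definition smoothable (C : fieldType) (A : comAlgType C) : Prop :=
  exists (B : idomainType) (iota : {rmorphism C -> B}) (b0 : {rmorphism B -> C})
         (F : comAlgType B) (s : nat) (e : 'I_s -> F) (pr : {rmorphism F -> A}),
    [/\ cancel iota b0,
        free_basis e,
        generically_smooth e,
        forall b x, pr (b *: x) = b0 b *: pr x
      & free_basis (fun i => pr (e i))].

Definition in_smoothable_span (C : fieldType) (m D : nat) (f : {mpoly C[m]})
    (s : nat) : Prop :=
  exists K : finite_subscheme C (dimR m D),
    [/\ subscheme_of K (@veronese C m D),
        scheme_length K s,
        smoothable (coord_ring K)
      & in_linear_span K (fcoef D f)].

Definition is_smoothable_rank (C : fieldType) (m D : nat) (f : {mpoly C[m]}) :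
    nat -> Prop :=
  is_least (in_smoothable_span D f).

(* The point [f] of P(R_D) requires f to be a nonzero form of degree D.      *)
Definition wild (C : fieldType) (m D : nat) (f : {mpoly C[m]}) : Prop :=
  [/\ f \is D.-homog, f != 0
    & exists r s, [/\ is_border_rank D f r, is_smoothable_rank D f s & (r < s)%N]].

(* The variables x_1, ..., x_n, u, v are numbered in this order; row i of L  *)
(* holds the coefficients of the linear form l_i.                            *)
Definition linform (C : fieldType) (n : nat) (c : 'rV[C]_n) : {mpoly C[n + 2]} :=
  \sum_(j < n) c 0 j *: 'X_(lshift 2 j).

Definition exceptional_form (C : fieldType) (n d : nat)
    (L : 'M[C]_('C(n.+1, 2), n)) : {mpoly C[n + 2]} :=
  let u := 'X_(rshift n ord0) in
  let v := 'X_(rshift n ord_max) in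
  \sum_(i < n) 'X_(lshift 2 i) * u ^+ (d - 2 * i) * v ^+ (2 * i).+1
  + \sum_i linform (row i L) ^+ (d + 2).

(* Main.v *)
Require Import Defs.
From HB Require Import structures.
From mathcomp Require Import all_boot all_order all_algebra all_field.
From mathcomp Require Import complex mpoly boolp reals ring spectral cyclic zify.
Set Implicit Arguments.
Unset Strict Implicit.
Unset Printing Implicit Defensive.
Import Order.TTheory GRing.Theory Num.Theory.
Local Open Scope ring_scope.

(* Let r = 'C(n + 1, 2) + d + 4.                                              *)
(*                                                                            *)
(* The border rank is at most r: with z a primitive root of unity of order    *)
(* d + 4 the powers (u + z^j v)^(d+2) satisfy a linear relation with nonzero  *)
(* coefficients, so moving the d + 4 points u + z^j v along tangent vectors   *)
(* in the x-directions produces the first part of f as a first-order term,    *)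
(* and h contributes its 'C(n + 1, 2) powers.                                 *)
(*                                                                            *)
(* The smoothable rank exceeds r: let K = Spec A be a subscheme of the        *)
(* Veronese variety of length at most r whose span contains [f]. Its ideal    *)
(* lies in the apolar ideal of f. The catalecticant of f in degree 3 has rank *)
(* r, so both ideals agree in degree 3; in particular x_i x_j u and x_i x_j v *)
(* vanish on K. Hence a linear form equal to 1 on K acts on the classes of    *)
(* the x_i u, x_i v as al u + be v. These classes span a space Z of dimension *)
(* d + 1, dual to the binary forms of degree d, whereas u Z + v Z, dual to    *)
(* the binary forms of degree d - 1, has dimension d: multiplication by 1     *)
(* would not be injective.                                                    *)

(** * Powers of linear forms *)

(** The bounds on the two ranks are [exceptional_form_in_secant] and [smoothable_span_gt]. For the
    first, [tangent_family] and [node_relation] turn the linear relation among the powers at the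
    nodes into a polynomial curve of sums of powers through f, and [in_secant_limit] passes to the
    limit. For the second, [affine_chart] inverts the Veronese map on K, so that forms can be
    evaluated in the coordinate ring A, and [apolarity] turns the span condition into a functional
    on A whose value at a form of degree d + 2 is its pairing with f. The dual families of
    [pairing_dual], of size r, leave no room in A for anything else ([dual_family_separates]), so
    every cubic apolar to f vanishes on K ([ev_eq0]); the relations obtained this way clash in
    [small_scheme_contradiction]. Genericity of the linear forms means that their coefficient
    vectors impose independent conditions on quadrics ([quadrics_separate]). That some smoothable
    scheme has [f] in its span, so that a least length exists, is [exists_in_smoothable_span]. *)

Lemma mmap1D n (R : comNzRingType) (h : 'I_n -> R) m1 m2 :
  mmap1 h (m1 + m2) = mmap1 h m1 * mmap1 h m2.
Proof. by apply: commr_mmap1_M => i x; apply: mulrC. Qed.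

Section Veronese.
Variables (C : numClosedFieldType) (m : nat).
Implicit Types (x : 'I_m -> C) (t : 'X_{1..m}).

Definition linear_form x : {mpoly C[m]} := \sum_j x j *: 'X_j.

Definition multinomial t : C := (mdeg t)`!%:R / (\prod_i (t i)`!)%:R.

Lemma multinomial_neq0 t : multinomial t != 0.
Proof.
rewrite mulf_neq0 ?invr_eq0 // pnatr_eq0 -lt0n ?fact_gt0 //.
by rewrite prodn_gt0 // => i; rewrite fact_gt0.
Qed.

Lemma mderiv_exp i (p : {mpoly C[m]}) k :
  (p ^+ k.+1)^`M(i) = (p ^+ k * p^`M(i)) *+ k.+1.
Proof.
elim: k => [|k IH]; first by rewrite expr1 expr0 mul1r mulr1n.
rewrite exprS mderivM IH mulrnAr mulrA -exprS mulrC [RHS]mulrS.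
by rewrite [p ^+ k.+1 * _]mulrC.
Qed.

Lemma mderiv_linear_form i x : (linear_form x)^`M(i) = (x i)%:MP.
Proof.
rewrite /linear_form linear_sum (bigD1 i) //= big1 ?addr0 => [|j ne_ji].
  rewrite linearZ /= mderivX mnm1E eqxx scale1r.
  rewrite (_ : (_ - _)%MM = 0%MM); first by rewrite mpolyX0 -mul_mpolyC mulr1.
  by apply/mnmP => k; rewrite mnmBE subnn mnm0E.
by rewrite linearZ /= mderivX mnm1E (negPf ne_ji) scale0r scaler0.
Qed.

(** Induction on [D]: differentiating in a variable that occurs in [t] lowers the power by one and
    shifts the coefficient. *)
Lemma mcoeff_linear_form_exp x D t : mdeg t = D ->
  (linear_form x ^+ D)@_t = multinomial t * mmap1 x t.
Proof.
move=> degt; apply: (mulIf (x := (\prod_i (t i)`!)%:R)).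
  by rewrite pnatr_eq0 -lt0n prodn_gt0 // => i; rewrite fact_gt0.
rewrite mulrAC divfK; last first.
  by rewrite pnatr_eq0 -lt0n prodn_gt0 // => i; rewrite fact_gt0.
rewrite degt; elim: D t degt => [|D IH] t degt.
  move/eqP: degt; rewrite mdeg_eq0 => /eqP ->.
  rewrite expr0 mcoeff1 eqxx mmap11 fact0 mulr1 big1 ?mulr1 // => i _.
  by rewrite mnm0E.
have [i ti] : exists i, (0 < t i)%N.
  apply/existsP; move: degt; rewrite mdegE; apply: contra_eqT.
  rewrite negb_exists => /forallP t0; rewrite big1 // => i _.
  by apply/eqP; rewrite -leqn0 leqNgt.
have [t' tE] : exists t', t = (t' + U_(i))%MM.
  exists (t - U_(i))%MM; rewrite submK //; apply/mnm_lepP => j.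
  by rewrite mnm1E; case: eqP => // <-.
subst t.
have degt' : mdeg t' = D by move: degt; rewrite mdegD mdeg1 addn1 => -[].
have prodE : (\prod_j ((t' + U_(i))%MM j)`! = (t' i).+1 * \prod_j (t' j)`!)%N.
  rewrite (bigD1 i) //= [in RHS](bigD1 i) //= mnmDE mnm1E eqxx addn1.
  rewrite factS -mulnA; congr (_ * (_ * _))%N; apply: eq_bigr => j ne_ji.
  by rewrite mnmDE mnm1E eq_sym (negPf ne_ji) addn0.
rewrite prodE natrM mulrA [_ * (t' i).+1%:R]mulr_natr -mcoeff_mderiv mderiv_exp.
rewrite mderiv_linear_form mcoeffMn mulrC [_ * _%:MP]mulrC mcoeffCM.
rewrite mulrnAr mulrC mulrnAl -mulrA.
rewrite (IH t' degt') mmap1D mmap1U mul1r factS mulnC mulrnA.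
by congr (_ *+ _); rewrite -[in RHS]mulr_natl; ring.
Qed.
End Veronese.

(** * Finite-dimensional algebras *)

Section FiniteAlgebra.
Variables (C : fieldType) (A : lmodType C) (s : nat) (e : 'I_s -> A).
Hypothesis eP : free_basis e.

Lemma free_basis_coord :
  exists cd : {linear A -> 'rV[C]_s},
    (forall a, \sum_i cd a 0 i *: e i = a) /\
    (forall v : 'rV_s, cd (\sum_i v 0 i *: e i) = v).
Proof.
have [g gK Kg] := eP.
pose cd a : 'rV[C]_s := \row_i g a i.
have cdK a : \sum_i cd a 0 i *: e i = a.
  by rewrite -[RHS]Kg; apply: eq_bigr => i _; rewrite mxE.
have Kcd (v : 'rV_s) : cd (\sum_i v 0 i *: e i) = v.
  apply/rowP => i; rewrite mxE.
  rewrite (eq_bigr (fun i => [ffun i => v 0 i] i *: e i)) => [|j _].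
    by rewrite gK ffunE.
  by rewrite ffunE.
have cd_lin : linear cd.
  move=> c x y; rewrite -[in LHS](cdK x) -[in LHS](cdK y) scaler_sumr -big_split /=.
  rewrite -[RHS]Kcd; congr cd; apply: eq_bigr => i _.
  by rewrite scalerA -scalerDl [in RHS]mxE [in RHS]mxE.
pose cdL := HB.pack_for {linear A -> 'rV[C]_s} cd
  (GRing.isLinear.Build _ _ _ _ cd cd_lin).
by exists cdL.
Qed.

(* By duality the family E is free, hence a basis.                            *)
Lemma dual_family_separates (J : finType) (E : J -> A) (Psi : J -> {scalar A}) :
  (forall j k, Psi k (E j) = (j == k)%:R) -> (s <= #|J|)%N ->
  forall a, (forall k, Psi k a = 0) -> a = 0.
Proof.
move=> dualE le_sJ a a0; have [cd [cdK Kcd]] := free_basis_coord.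
pose X := \matrix_(j < #|J|) cd (E (enum_val j)).
pose Y := \matrix_(i < s, k < #|J|) Psi (enum_val k) (e i).
have PsiE k b : Psi (enum_val k) b = (cd b *m Y) 0 k.
  rewrite -{1}(cdK b) linear_sum mxE; apply: eq_bigr => i _.
  by rewrite linearZ mxE.
have XY : X *m Y = 1%:M.
  apply/matrixP => j k; rewrite [RHS]mxE -(inj_eq enum_val_inj) -dualE PsiE.
  by rewrite !mxE; apply: eq_bigr => i _; rewrite !mxE.
have rkY : row_free Y.
  rewrite /row_free eqn_leq rank_leq_row (leq_trans le_sJ) //.
  have := mxrankM_maxr X Y; by rewrite XY mxrank1.
have cda : cd a = 0.
  apply: (row_free_inj rkY); rewrite mul0mx; apply/rowP => k.
  by rewrite -PsiE a0 mxE.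
by rewrite -(cdK a) cda big1 // => i _; rewrite mxE scale0r.
Qed.
End FiniteAlgebra.

Section Characters.
Variables (C : numClosedFieldType) (A : comAlgType C) (s : nat) (e : 'I_s -> A).
Hypothesis eP : free_basis e.

(* The diagonal entries of a simultaneous triangularisation of the regular    *)
(* representation detect the units of A.                                      *)
Lemma characters_detect_units :
  exists chi : 'I_s -> {scalar A}, (forall i, chi i 1 = 1) /\
    forall a, (forall i, chi i a != 0) -> exists b, b * a = 1.
Proof.
have [cd [cdK Kcd]] := free_basis_coord eP.
(* The regular representation, acting on coordinate rows from the right. *)
pose M a : 'M[C]_s := \matrix_i cd (e i * a).
have cdM a b : cd (a * b) = cd a *m M b.
  rewrite -{1}(cdK a) mulr_suml linear_sum mulmx_sum_row.
  by apply: eq_bigr => i _; rewrite -scalerAl linearZ /= rowK.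
have M_lin : linear M.
  move=> c a b; apply/row_matrixP => i.
  by rewrite linearP /= !rowK mulrDr -scalerAr linearP.
have M1 : M 1 = 1%:M.
  apply/row_matrixP => i; rewrite rowK mulr1 row1.
  rewrite -[RHS]Kcd (bigD1 i) //= big1 ?addr0 => [|j ne_ji].
    by rewrite mxE !eqxx scale1r.
  by rewrite mxE (negPf ne_ji) andbF scale0r.
pose As := [seq M (e i) | i : 'I_s].
have As_comm : {in As &, forall X Y, comm_mx X Y}.
  move=> _ _ /mapP[i _ ->] /mapP[j _ ->]; rewrite /comm_mx.
  by apply/row_matrixP => k; rewrite !row_mul !rowK -!cdM mulrAC.
have [P Punitary Ptrig] := cotrigonalization As_comm.
have Punit := unitarymx_unit Punitary.
pose ML := HB.pack_for {linear A -> 'M[C]_s} M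
  (GRing.isLinear.Build _ _ _ _ M M_lin).
pose T a := P *m M a *m invmx P.
have T_lin : linear T.
  by move=> c a b; rewrite /T M_lin mulmxDr mulmxDl -scalemxAr -scalemxAl.
have T_trig a : is_trig_mx (T a).
  apply/is_trig_mxP => i j lt_ij.
  have -> : T a = P *m (\sum_k cd a 0 k *: M (e k)) *m invmx P.
    rewrite -{1}(cdK a) /T -[M _]/(ML _) linear_sum /=.
    by under eq_bigr do rewrite -[M _]/(ML _) linearZ.
  rewrite mulmx_sumr mulmx_suml summxE big1 // => k _.
  rewrite -scalemxAr -scalemxAl mxE.
  have /(allP Ptrig) : M (e k) \in As by apply: image_f.
  rewrite /= /similar_to conjumx //.
  by move=> /is_trig_mxP /(_ i j lt_ij) ->; rewrite mulr0.
have chi_lin i : scalar (fun a => T a i i).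
  by move=> c a b; rewrite T_lin !mxE.
pose chi i := HB.pack_for {scalar A} (fun a => T a i i)
  (GRing.isLinear.Build _ _ _ _ (fun a => T a i i) (chi_lin i)).
exists chi; split=> [i|a a_neq0]; first by rewrite /= /T M1 mulmx1 mulmxV // mxE eqxx.
have Munit : M a \in unitmx.
  have : \det (T a) != 0 by rewrite det_trig //; apply/prodf_neq0 => i _; apply: a_neq0.
  by rewrite /T !det_mulmx det_inv mulrAC divff ?mul1r -?unitfE.
(* Since [M a] is invertible, b * a = 1 can be solved in coordinates. *)
exists (\sum_i (cd 1 *m invmx (M a)) 0 i *: e i).
by rewrite -[LHS]cdK cdM Kcd mulmxKV // cdK.
Qed.
End Characters.

(** * Nonzero polynomials take nonzero values *)

Section Nonvanishing.
Variable F : numFieldType.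

Lemma poly_nonroot (q : {poly F}) : q != 0 -> exists a, q.[a] != 0.
Proof.
move=> q0; pose rs : seq F := [seq i%:R | i <- iota 0 (size q)].
have [/(max_poly_roots q0) | /allPn[a _]] := boolP (all (root q) rs); last by exists a.
rewrite map_inj_uniq ?iota_uniq; last by move=> i j /eqP; rewrite eqr_nat => /eqP.
by rewrite size_map size_iota ltnn => /(_ isT).
Qed.

Lemma mcoeff_muni n (p : {mpoly F[n.+1]}) (t : 'X_{1..n.+1}) :
  ((muni p)`_(t ord_max))@_[multinom t (widen_ord (leqnSn n) i) | i < n] = p@_t.
Proof.
rewrite muniE coef_sum raddf_sum /=.
have termE m : ((p@_m *: 'X_[[multinom m (widen_ord (leqnSn n) i) | i < n]]
    *: 'X^(m ord_max))`_(t ord_max))@_[multinom t (widen_ord (leqnSn n) i) | i < n]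
    = p@_m * (m == t)%:R.
  rewrite coefZ coefXn mulr_natr mcoeffMn mcoeffZ mcoeffX -mulrnAr -mulrnA mulnb.
  congr (_ * _%:R); congr (nat_of_bool _).
  apply/andP/eqP => [[/eqP/mnmP eqw /eqP eqmax]|->]; last by [].
  apply/mnmP => i; have [j ->|->] := unliftP ord_max i; last by [].
  have -> : lift ord_max j = widen_ord (leqnSn n) j by exact/val_inj/lift_max.
  by have := eqw j; rewrite !mnmE.
under eq_bigr do rewrite termE.
have [tp|tp] := boolP (t \in msupp p).
  rewrite (bigD1_seq t) //= eqxx mulr1 big1 ?addr0 // => m /negPf ->.
  by rewrite mulr0.
rewrite (memN_msupp_eq0 tp) big_seq big1 // => m mp; case: eqP => [mt|_].
  by rewrite mt (negPf tp) in mp.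
by rewrite mulr0.
Qed.

Lemma meval_muni n (p : {mpoly F[n.+1]}) (x : 'I_n -> F) (a : F) :
  p.@[fun i => oapp x a (unlift ord_max i)] = (map_poly (meval x) (muni p)).[a].
Proof.
rewrite muniE rmorph_sum horner_sum mevalE; apply: eq_bigr => m _.
rewrite /= map_polyZ map_polyXn hornerZ hornerXn /= mevalZ mevalX -mulrA.
rewrite big_ord_recr /= unlift_none /=; congr (_ * (_ * _)).
apply: eq_bigr => i _; rewrite mnmE.
have -> : widen_ord (leqnSn n) i = lift ord_max i by exact/val_inj/esym/lift_max.
by rewrite liftK.
Qed.

Lemma mpoly_nonroot n (p : {mpoly F[n]}) : p != 0 -> exists x, p.@[x] != 0.
Proof.
elim: n p => [|n IH] p p0.
  exists (fun=> 0); rewrite (nvar0_mpolyC p) mevalC.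
  by apply: contraNneq p0 => pE; rewrite (nvar0_mpolyC p) pE mpolyC0.
have t_supp := mlead_supp p0; pose t := mlead p.
have : (muni p)`_(t ord_max) != 0.
  apply: contraTneq t_supp => q0.
  by rewrite mcoeff_msupp -(mcoeff_muni p t) q0 mcoeff0 eqxx.
case/IH => x x0; have [|a a0] := @poly_nonroot (map_poly (meval x) (muni p)).
  by apply: contraNneq x0 => /polyP/(_ (t ord_max)); rewrite coef_map coef0 => ->.
by exists (fun i => oapp x a (unlift ord_max i)); rewrite meval_muni.
Qed.
End Nonvanishing.

(** * Finite subschemes of the Veronese variety *)

Section Monomials.
Variables (m D : nat).

Definition mexp (k : 'I_(dimR m D)) : 'X_{1..m} := val (val (enum_val k : mon m D)).

Lemma mdeg_mexp k : mdeg (mexp k) = D.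
Proof. exact/eqP/(valP (enum_val k : mon m D)). Qed.

Lemma mexp_inj : injective mexp.
Proof. by move=> k l /val_inj/val_inj/enum_val_inj. Qed.

Lemma mexp_surj t : mdeg t = D -> exists k, mexp k = t.
Proof.
move=> degt; have ltt : (mdeg t < D.+1)%N by rewrite degt.
have degt' : mdeg (BMultinom ltt) == D by rewrite /= degt.
exists (enum_rank (Sub (BMultinom ltt) degt' : mon m D)).
by rewrite /mexp enum_rankK.
Qed.

Variable C : fieldType.

Lemma fcoefE (f : {mpoly C[m]}) k : fcoef D f 0 k = f@_(mexp k).
Proof. by rewrite mxE. Qed.

Lemma dhomog_sum_mexp (f : {mpoly C[m]}) : f \is D.-homog ->
  f = \sum_k f@_(mexp k) *: 'X_[mexp k].
Proof.
move=> homf; apply/mpolyP => t; rewrite raddf_sum /=.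
under eq_bigr do rewrite mcoeffZ mcoeffX.
have [degt|ne_tD] := eqVneq (mdeg t) D.
  have [k <-] := mexp_surj degt.
  rewrite (bigD1 k) //= eqxx mulr1 big1 ?addr0 // => l ne_lk.
  by rewrite (inj_eq mexp_inj) (negPf ne_lk) mulr0.
rewrite (dhomog_nemf_coeff homf ne_tD) big1 // => k _.
case: eqP => [tE|_]; last by rewrite mulr0.
by rewrite -tE mdeg_mexp eqxx in ne_tD.
Qed.
End Monomials.

Lemma dhomog_prod_exp n (R : idomainType) (I : finType) (p : I -> {mpoly R[n]})
    (d t : I -> nat) : (forall i, p i \is (d i).-homog) ->
  \prod_i p i ^+ t i \is (\sum_i d i * t i).-homog.
Proof.
move=> homp; elim/big_rec2: _ => [|i k q _ homq]; first exact: dhomog1.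
exact/dhomogM/homq/dhomogMn.
Qed.

Section LinearForms.
Variables (C : numClosedFieldType) (m : nat).

Lemma linear_form_homog x : linear_form (C := C) (m := m) x \is 1.-homog.
Proof. by apply: rpred_sum => i _; rewrite rpredZ // dhomogX /= mdeg1. Qed.

Lemma mcoeff_linear_form x i : (linear_form (C := C) (m := m) x)@_U_(i) = x i.
Proof.
rewrite raddf_sum (bigD1 i) //= mcoeffZ mcoeffXU eqxx mulr1 big1 ?addr0 //.
by move=> j ne_ji; rewrite mcoeffZ mcoeffXU (negPf ne_ji) mulr0.
Qed.

Lemma dhomog1_linear_form (l : {mpoly C[m]}) : l \is 1.-homog ->
  l = linear_form (fun i => l@_U_(i)).
Proof.
move=> homl; apply/mpolyP => t; have [|ne_t1] := eqVneq (mdeg t) 1%N.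
  by move/eqP/mdeg1P => [i /eqP ->]; rewrite mcoeff_linear_form.
by rewrite !(dhomog_nemf_coeff _ ne_t1) ?linear_form_homog.
Qed.

Lemma meval_linear_form (x y : 'I_m -> C) : (linear_form x).@[y] = \sum_i x i * y i.
Proof. by rewrite raddf_sum; apply: eq_bigr => i _; rewrite /= mevalZ mevalXU. Qed.

Lemma veroneseP D (y : 'rV[C]_(dimR m D)) : veronese y ->
  exists x, y = fcoef D (linear_form x ^+ D).
Proof. by case=> l [homl _ ->]; eexists; rewrite {1}(dhomog1_linear_form homl). Qed.
End LinearForms.

Section SubschemeOfVeronese.
Variables (C : numClosedFieldType) (m D : nat).
Variable K : finite_subscheme C (dimR m D).
Hypothesis KV : subscheme_of K (@veronese C m D).
Let A := coord_ring K.
Let h : 'I_(dimR m D) -> A := @hcoord _ _ K.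

(** The linear form on P(R_D) that restricts to [p] on the Veronese variety; dividing by the
    multinomials compensates for the coefficients of a power of a linear form. *)
Definition veronese_dual (p : {mpoly C[m]}) : {mpoly C[dimR m D]} :=
  linear_form (fun k => p@_(mexp k) / multinomial C (mexp k)).

Lemma veronese_dual_homog p : veronese_dual p \is 1.-homog.
Proof. exact: linear_form_homog. Qed.

Lemma evalr_veronese_dual p x : p \is D.-homog ->
  evalr (veronese_dual p) (fcoef D (linear_form x ^+ D)) = p.@[x].
Proof.
move=> homp; rewrite /evalr meval_linear_form {2}(dhomog_sum_mexp homp) raddf_sum.
apply: eq_bigr => k _; rewrite fcoefE /= mevalZ mevalX.
rewrite (mcoeff_linear_form_exp _ (mdeg_mexp k)) mulrA divfK //.
exact: multinomial_neq0.
Qed.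

Definition tautological_eval p : A :=
  \sum_k (p@_(mexp k) / multinomial C (mexp k)) *: h k.

Lemma evalA_veronese_dual p : evalA h (veronese_dual p) = tautological_eval p.
Proof.
rewrite /evalA raddf_sum; apply: eq_bigr => k _ /=.
by rewrite mmapZ mmapX mmap1U /= mulr_algl.
Qed.

Lemma tautological_eval_linear_form_exp x :
  tautological_eval (linear_form x ^+ D) = \sum_k mmap1 x (mexp k) *: h k.
Proof.
apply: eq_bigr => k _; rewrite (mcoeff_linear_form_exp _ (mdeg_mexp k)).
by rewrite mulrAC divff ?mul1r ?multinomial_neq0.
Qed.

(** Some linear form vanishes at no point of K. For each character the value in question is a
    polynomial in the coefficients [x], nonzero because the chart condition forbids all coordinates
    to be killed; a nonroot of the product serves all characters at once. *)
Lemma tautological_eval_unit : exists x b,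
  b * tautological_eval (linear_form x ^+ D) = 1.
Proof.
have [s [e eP]] := finite_coord_ring K; have [lam lamP] := chart K.
have [chi [chi1 chiU]] := characters_detect_units eP.
pose P i : {mpoly C[m]} := \sum_k chi i (h k) *: 'X_[mexp k].
have P0 i : P i != 0.
  apply: contra_neq (oner_neq0 C) => Pi0; rewrite -(chi1 i) -lamP linear_sum.
  rewrite big1 // => k _; rewrite linearZ /=.
  have := congr1 (mcoeff (mexp k)) Pi0; rewrite mcoeff0 raddf_sum /= (bigD1 k) //=.
  rewrite mcoeffZ mcoeffX eqxx mulr1 big1 ?addr0 => [->|l ne_lk]; first by rewrite mulr0.
  by rewrite mcoeffZ mcoeffX (inj_eq (@mexp_inj _ _)) (negPf ne_lk) mulr0.
have : \prod_i P i != 0 by apply/prodf_neq0 => i _.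
case/mpoly_nonroot => x; rewrite rmorph_prod => /prodf_neq0 Px.
exists x; apply: chiU => i.
suff -> : chi i (tautological_eval (linear_form x ^+ D)) = (P i).@[x] by apply: Px.
rewrite tautological_eval_linear_form_exp linear_sum raddf_sum /=.
apply: eq_bigr => k _.
by rewrite linearZ /= mevalZ mulrC mevalX.
Qed.

(* The Veronese embedding maps a point y to all monomials of degree D in y;   *)
(* comparing two products of D of them gives this relation.                   *)
Lemma tautological_eval_monomial x t : mdeg t = D -> (0 < D)%N ->
  tautological_eval 'X_[t] * tautological_eval (linear_form x ^+ D) ^+ D.-1
  = \prod_i tautological_eval ('X_i * linear_form x ^+ D.-1) ^+ t i.
Proof.
move=> degt D_gt0; set l := linear_form x.
have homl : l ^+ D.-1 \is D.-1.-homog.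
  by have := dhomogMn D.-1 (linear_form_homog x); rewrite mul1n.
have homX i : 'X_i * l ^+ D.-1 \is D.-homog.
  by rewrite -{2}(prednK D_gt0) -add1n; apply: dhomogM; rewrite // dhomogX /= mdeg1.
have homlD : l ^+ D \is D.-homog.
  by have := dhomogMn D (linear_form_homog x); rewrite mul1n.
have homt : 'X_[C, t] \is D.-homog by rewrite dhomogX /= degt.
pose G := veronese_dual 'X_[t] * veronese_dual (l ^+ D) ^+ D.-1
  - \prod_i veronese_dual ('X_i * l ^+ D.-1) ^+ t i.
have homG : G \is D.-homog.
  apply: rpredB.
    have := dhomogM (veronese_dual_homog 'X_[t])
      (dhomogMn D.-1 (veronese_dual_homog (l ^+ D))).
    by rewrite mul1n add1n (prednK D_gt0).
  have sumE : (\sum_i 1 * t i)%N = D.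
    by rewrite -degt mdegE; apply: eq_bigr => i _; rewrite mul1n.
  have := dhomog_prod_exp (d := fun=> 1%N) t
    (fun i => veronese_dual_homog ('X_i * l ^+ D.-1)).
  by rewrite /= sumE.
(* The relation holds at every point of the Veronese variety, hence on K by [KV]. *)
have GV y : veronese y -> evalr G y = 0.
  case/veroneseP => z ->; have ev p := @evalr_veronese_dual p z.
  rewrite /evalr in ev *; rewrite rmorphB rmorphM rmorphXn rmorph_prod /= !ev //.
  under eq_bigr do rewrite rmorphXn /= ev // mevalM rmorphXn /= mevalXU exprMn.
  rewrite big_split prodrXr -mdegE degt mevalX rmorphXn /= -!exprM.
  by rewrite mulnC subrr.
have ev p := evalA_veronese_dual p; rewrite /evalA in ev.
have := KV homG GV; rewrite /evalA -/h rmorphB rmorphM rmorphXn rmorph_prod /= !ev.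
under eq_bigr do rewrite rmorphXn /= ev.
by move/eqP; rewrite subr_eq0 => /eqP.
Qed.

(** Inverse of the Veronese map where l is invertible: [a i] is X_i l^(D-1) divided by l^D. The
    factor [w] accounts for the coordinates of K being normalised by another linear form. *)
Lemma affine_chart : (0 < D)%N -> exists x (a : 'I_m -> A) (w : A),
  \sum_i x i *: a i = 1 /\
  forall k, h k = multinomial C (mexp k) *: (w * mmap1 a (mexp k)).
Proof.
move=> D_gt0; have [x [b bE]] := tautological_eval_unit.
have expD (B : pzRingType) (y : B) : y ^+ D = y * y ^+ D.-1 by rewrite -exprS prednK.
set w := tautological_eval _ in bE.
pose a i : A := b * tautological_eval ('X_i * linear_form x ^+ D.-1).
exists x, a, w; split=> [|k].
  under eq_bigr do rewrite scalerAr.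
  rewrite -mulr_sumr -bE; congr (_ * _).
  rewrite /tautological_eval; under eq_bigr do rewrite scaler_sumr.
  rewrite exchange_big; apply: eq_bigr => k _ /=.
  under eq_bigr do rewrite scalerA mulrA.
  rewrite -scaler_suml; congr (_ *: _); rewrite -mulr_suml; congr (_ / _).
  rewrite expD {2}/linear_form mulr_suml raddf_sum /=.
  by apply: eq_bigr => i _; rewrite -scalerAl mcoeffZ.
have := tautological_eval_monomial x (mdeg_mexp k) D_gt0; rewrite -/w => wE.
have -> : mmap1 a (mexp k) = b * tautological_eval 'X_[mexp k].
  rewrite /mmap1; under eq_bigr do rewrite exprMn.
  rewrite big_split prodrXr -mdegE mdeg_mexp -wE /=.
  by rewrite expD mulrACA -exprMn bE expr1n mulr1.
rewrite mulrA [w * b]mulrC bE mul1r /tautological_eval (bigD1 k) //= big1.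
  rewrite addr0 mcoeffX eqxx scalerA mulrA mulr1 divff ?scale1r //.
  exact: multinomial_neq0.
move=> l ne_lk; rewrite mcoeffX eq_sym (inj_eq (@mexp_inj _ _)) (negPf ne_lk).
by rewrite mul0r scale0r.
Qed.
End SubschemeOfVeronese.

(** By duality, a vector satisfying all linear relations among the coordinates on K is their image
    under a functional. *)
Lemma linear_span_functional (C : fieldType) N (K : finite_subscheme C N) (x : 'rV[C]_N) :
  in_linear_span K x ->
  exists psi : {scalar coord_ring K}, forall k, x 0 k = psi (@hcoord _ _ K k).
Proof.
move=> xK; have [s [e eP]] := finite_coord_ring K.
have [cd [cdK Kcd]] := free_basis_coord eP.
pose H := \matrix_(k < N) cd (@hcoord _ _ K k).
have : (x <= H^T)%MS.
  rewrite submxE; apply/eqP/rowP => j; rewrite !mxE.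
  transitivity (\sum_k cokermx H^T k j * x 0 k).
    by apply: eq_bigr => k _; rewrite mulrC.
  apply: xK; rewrite -[LHS]cdK linear_sum /= big1 // => i _.
  suff -> : (\sum_k cd (cokermx H^T k j *: @hcoord _ _ K k)) 0 i = 0 by rewrite scale0r.
  have /matrixP/(_ i j) := mulmx_coker H^T; rewrite !mxE => <-.
  by rewrite summxE; apply: eq_bigr => k _; rewrite linearZ !mxE mulrC.
case/submxP => y xE.
pose psi a := (cd a *m y^T) 0 0.
have psi_lin : scalar psi by move=> c a b; rewrite /psi linearP mulmxDl -scalemxAl !mxE.
pose psiL := HB.pack_for {scalar coord_ring K} psi
  (GRing.isLinear.Build _ _ _ _ psi psi_lin).
exists psiL => k; rewrite /= /psi xE !mxE; apply: eq_bigr => i _.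
by rewrite !mxE mulrC.
Qed.

Section Apolarity.
Variables (C : numClosedFieldType) (m D : nat) (f : {mpoly C[m]}).

(* Contraction of f by p, up to the scalar D!.                                *)
Definition apolar_pairing (p : {mpoly C[m]}) : C :=
  \sum_(k < dimR m D) p@_(mexp k) * (f@_(mexp k) / multinomial C (mexp k)).

(** A form q vanishing on K therefore pairs to zero with f after multiplication by any form of
    complementary degree: the ideal of K is apolar to f. The factor [w] of the chart is absorbed
    into [psi]. *)
Lemma apolarity (K : finite_subscheme C (dimR m D)) :
    subscheme_of K (@veronese C m D) -> in_linear_span K (fcoef D f) -> (0 < D)%N ->
  exists x (a : 'I_m -> coord_ring K) (psi : {scalar coord_ring K}),
    \sum_i x i *: a i = 1 /\
    forall p, p \is D.-homog -> psi (mmap (in_alg (coord_ring K)) a p) = apolar_pairing p.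
Proof.
move=> KV fK D_gt0; have [x [a [w [xa1 hE]]]] := affine_chart KV D_gt0.
have [phi phiE] := linear_span_functional fK.
have phiw_lin : scalar (fun b => phi (w * b)).
  by move=> c y z; rewrite mulrDr -scalerAr linearP.
pose psi := HB.pack_for {scalar coord_ring K} (fun b => phi (w * b))
  (GRing.isLinear.Build _ _ _ _ (fun b => phi (w * b)) phiw_lin).
exists x, a, psi; split=> // p homp.
rewrite {1}(dhomog_sum_mexp homp) [mmap _ _ _]raddf_sum [psi _]linear_sum.
apply: eq_bigr => k _ /=; rewrite mmapZ mmapX mulr_algl -scalerAr linearZ /=.
congr (_ * _); rewrite -fcoefE phiE hE linearZ mulrAC divff ?mul1r //.
exact: multinomial_neq0.
Qed.
End Apolarity.

(** * Secant varieties *)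

Section SecantLimits.
Variables (C : numClosedFieldType) (m D : nat).

Lemma fcoef_sum (I : finType) (c : I -> C) (p : I -> {mpoly C[m]}) :
  fcoef D (\sum_i c i *: p i) = \sum_i c i *: fcoef D (p i).
Proof.
apply/rowP => k; rewrite mxE raddf_sum summxE; apply: eq_bigr => i _.
by rewrite /= mcoeffZ !mxE.
Qed.

Lemma secant_union_powers (I : finType) (c : I -> C) (l : I -> {mpoly C[m]}) :
    (forall i, l i \is 1.-homog) -> (forall i, l i != 0) ->
  secant_union #|I| (fcoef D (\sum_i c i *: l i ^+ D)).
Proof.
move=> homl l0; exists (fun i => fcoef D (l (enum_val i) ^+ D)), (fun i => c (enum_val i)).
split=> [i|]; first by exists (l (enum_val i)).
rewrite fcoef_sum (reindex (fun i : 'I_#|I| => enum_val i)) //.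
exact/onW_bij/enum_val_bij.
Qed.

(** Along the curve a form [G] vanishing on the secant union is a polynomial in t with infinitely
    many roots. *)
Lemma in_secant_limit s K (F : nat -> {mpoly C[m]}) :
    fcoef D (F 0%N) != 0 ->
    (forall t, t != 0 -> secant_union s (fcoef D (\sum_(a < K.+1) t ^+ a *: F a))) ->
  in_secant D (F 0%N) s.
Proof.
move=> F0 secF k G homG GS.
pose P (i : 'I_(dimR m D)) : {poly C} := \sum_(a < K.+1) (F a)@_(mexp i) *: 'X^a.
have PE t i : (P i).[t] = fcoef D (\sum_(a < K.+1) t ^+ a *: F a) 0 i.
  rewrite horner_sum fcoefE raddf_sum; apply: eq_bigr => a _.
  by rewrite /= hornerZ hornerXn mcoeffZ mulrC.
pose Q : {poly C} := mmap polyC P G.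
have QE t : Q.[t] = evalr G (fcoef D (\sum_(a < K.+1) t ^+ a *: F a)).
  rewrite /Q /mmap horner_sum /evalr mevalE; apply: eq_bigr => u _.
  rewrite hornerM hornerC /mmap1 horner_prod; congr (_ * _).
  by apply: eq_bigr => i _; rewrite horner_exp PE.
have at0 : \sum_(a < K.+1) 0 ^+ a *: F a = F 0%N.
  rewrite big_ord_recl expr0 scale1r big1 ?addr0 // => a _.
  by rewrite expr0n scale0r.
have [i Fi0] : exists i, fcoef D (F 0%N) 0 i != 0 by apply/rV0Pn.
apply/eqP; apply: contraT => Gf.
(* The factor 'X avoids t = 0, and [P i] avoids parameters where the curve meets the zero vector,
   which is no projective point. *)
have : Q * P i * 'X != 0.
  rewrite !mulf_neq0 ?polyX_eq0 //.
    by apply: contraNneq Gf => Q0; rewrite -at0 -QE Q0 horner0.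
  by apply: contraNneq Fi0 => P0; rewrite -at0 -PE P0 horner0.
case/poly_nonroot => t; rewrite !hornerM hornerX !mulf_eq0 !negb_or.
case/andP => /andP[Qt Pt] t0; rewrite QE GS ?eqxx // in Qt; last exact: secF.
by apply: contraNneq Pt => y0; rewrite PE y0 mxE.
Qed.

(* The relation cancels the pole at t = 0 of this family of sums of powers.   *)
Lemma tangent_family (I : finType) (c : I -> C) (l y : I -> {mpoly C[m]}) t :
    \sum_i c i *: l i ^+ D = 0 -> t != 0 ->
  \sum_i (c i / t) *: (l i + t *: y i) ^+ D
  = \sum_(a < D) t ^+ a *:
      \sum_i c i *: ((l i ^+ (D - a.+1) * y i ^+ a.+1) *+ 'C(D, a.+1)).
Proof.
move=> rel t0.
have expE i : (l i + t *: y i) ^+ D = l i ^+ D + \sum_(a < D) t ^+ a.+1 *: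
    ((l i ^+ (D - a.+1) * y i ^+ a.+1) *+ 'C(D, a.+1)).
  rewrite exprDn big_ord_recl subn0 expr0 mulr1 bin0 mulr1n; congr (_ + _).
  by apply: eq_bigr => a _; rewrite exprZn -scalerAr -scalerMnr.
have cE i : (c i / t) *: (l i + t *: y i) ^+ D = (t^-1 * c i) *: l i ^+ D +
    \sum_(a < D) (t ^+ a * c i) *:
      ((l i ^+ (D - a.+1) * y i ^+ a.+1) *+ 'C(D, a.+1)).
  rewrite expE scalerDr [c i / t]mulrC scaler_sumr; congr (_ + _).
  apply: eq_bigr => a _; rewrite scalerA; congr (_ *: _).
  by rewrite exprS mulrACA mulVf // mul1r mulrC.
under eq_bigr do rewrite cE.
rewrite big_split /=; under eq_bigr do rewrite -scalerA.
rewrite -scaler_sumr rel scaler0 add0r exchange_big; apply: eq_bigr => a _ /=.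
by rewrite scaler_sumr; apply: eq_bigr => i _; rewrite scalerA.
Qed.

End SecantLimits.

(** * Roots of unity *)

Section RootsOfUnity.
Variable C : numClosedFieldType.

Lemma prim_root_exists N : (0 < N)%N -> exists z : C, N.-primitive_root z.
Proof.
move=> N_gt0; have mon : 'X^N - 1 \is @monic C by apply: monicXnsubC.
have [r] := closed_field_poly_normal ('X^N - 1 : {poly C}).
rewrite (monicP mon) scale1r => rE.
have unity : all N.-unity_root r.
  by apply/allP => z; rewrite -root_prod_XsubC -rE.
have r_uniq : uniq r.
  by rewrite -separable_prod_XsubC -rE separable_Xn_sub_1 // pnatr_eq0 -lt0n.
have [|z _ zP] := hasP (has_prim_root N_gt0 unity r_uniq _); last by exists z.
have := congr1 (fun p : {poly C} => size p) rE.
by rewrite size_XnsubC // size_prod_XsubC => -[->].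
Qed.

Lemma sum_prim_root N (z : C) k : N.-primitive_root z ->
  \sum_(j < N) z ^+ (j * k) = if (N %| k)%N then N%:R else 0.
Proof.
move=> zP; rewrite (eq_bigr (fun j : 'I_N => (z ^+ k) ^+ j)) => [|j _]; last first.
  by rewrite -exprM mulnC.
rewrite (prim_order_dvd zP); case: eqP => [->|/eqP zk].
  by under eq_bigr do rewrite expr1n; rewrite sumr_const card_ord.
apply: (mulfI (x := z ^+ k - 1)); first by rewrite subr_eq0.
by rewrite -subrX1 mulr0 -exprM mulnC exprM (prim_expr_order zP) expr1n subrr.
Qed.
End RootsOfUnity.

Lemma mcoeffMX_eq0 (R : nzRingType) n (p : {mpoly R[n]}) m t :
  ~~ (m <= t)%MM -> (p * 'X_[m])@_t = 0.
Proof.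
move=> nle_mt; apply: memN_msupp_eq0; rewrite (perm_mem (msuppMX p m)).
by apply: contra nle_mt => /mapP[t' _ ->]; apply: lem_addr.
Qed.

(** Pairing with a monomial reads off a weighted coefficient; pairing with a power of a linear form
    evaluates at its coefficient vector. *)
Lemma apolar_pairingE (C : numClosedFieldType) m D (I J : finType)
    (t : I -> 'X_{1..m}) (x : J -> 'I_m -> C) (p : {mpoly C[m]}) :
    (forall i, mdeg (t i) = D) -> p \is D.-homog ->
  apolar_pairing D (\sum_i 'X_[t i] + \sum_j linear_form (x j) ^+ D) p
  = \sum_i p@_(t i) / multinomial C (t i) + \sum_j p.@[x j].
Proof.
move=> degt homp; rewrite /apolar_pairing.
under eq_bigr do rewrite mcoeffD mulrDl mulrDr.
rewrite big_split /=; congr (_ + _).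
  under eq_bigr do rewrite raddf_sum /= mulr_suml mulr_sumr.
  rewrite exchange_big /=; apply: eq_bigr => i _.
  have [k kE] := mexp_surj (degt i); rewrite (bigD1 k) //= big1 ?addr0 => [|l ne_lk].
    by rewrite kE mcoeffX eqxx mul1r.
  by rewrite -kE mcoeffX eq_sym (inj_eq (@mexp_inj _ _)) (negPf ne_lk) mul0r mulr0.
under eq_bigr do rewrite raddf_sum /= mulr_suml mulr_sumr.
rewrite exchange_big /=; apply: eq_bigr => j _.
rewrite {2}(dhomog_sum_mexp homp) raddf_sum; apply: eq_bigr => k _.
rewrite /= mevalZ mevalX (mcoeff_linear_form_exp _ (mdeg_mexp k)).
by rewrite mulrAC divff ?mul1r ?multinomial_neq0.
Qed.

Section ApolarLinear.
Variables (C : numClosedFieldType) (m D : nat) (f : {mpoly C[m]}).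

Fact apolar_pairing_is_scalar : scalar (apolar_pairing D f).
Proof.
move=> c p q; rewrite /apolar_pairing mulr_sumr -big_split /=.
by apply: eq_bigr => k _; rewrite mcoeffD mcoeffZ mulrDl -[in LHS]mulrA.
Qed.

HB.instance Definition _ := GRing.isLinear.Build C {mpoly C[m]} C _
  (apolar_pairing D f) apolar_pairing_is_scalar.
End ApolarLinear.

(** * The exceptional form *)

(* The number of variables x_i is n.+1 here, and they are numbered from 0.    *)
Section ExceptionalForm.
Variables (C : numClosedFieldType) (n : nat).
Let d := n.*2.+1.
Variable L : 'M[C]_('C(n.+2, 2), n.+1).
Let f : {mpoly C[n.+1 + 2]} := exceptional_form d L.

Definition xvar (i : nat) : 'I_(n.+1 + 2) := lshift 2 (inord i).
Definition uvar : 'I_(n.+1 + 2) := rshift n.+1 ord0.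
Definition vvar : 'I_(n.+1 + 2) := rshift n.+1 ord_max.

Definition pad (c : 'rV[C]_n.+1) (j : 'I_(n.+1 + 2)) : C :=
  if split j is inl i then c 0 i else 0.

Definition uvmon a b : 'X_{1..n.+1 + 2} := (U_(uvar) *+ a + U_(vvar) *+ b)%MM.
Definition xuvmon (i : nat) : 'X_{1..n.+1 + 2} :=
  (U_(xvar i) + uvmon (d - i.*2) i.*2.+1)%MM.

Lemma pad_lshift c i : pad c (lshift 2 i) = c 0 i.
Proof. by rewrite /pad (unsplitK (inl i)). Qed.

Lemma pad_rshift c i : pad c (rshift n.+1 i) = 0.
Proof. by rewrite /pad (unsplitK (inr i)). Qed.

Lemma uv_neq : (uvar == vvar) = false.
Proof. by rewrite /uvar /vvar eq_rshift. Qed.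

Lemma uvmon_xvar a b i : uvmon a b (lshift 2 i) = 0%N.
Proof. by rewrite mnmDE !mulmnE !mnm1E /uvar /vvar !eq_rlshift. Qed.

Lemma uvmon_u a b : uvmon a b uvar = a.
Proof. by rewrite mnmDE !mulmnE !mnm1E eqxx eq_sym uv_neq mul1n mul0n addn0. Qed.

Lemma uvmon_v a b : uvmon a b vvar = b.
Proof. by rewrite mnmDE !mulmnE !mnm1E eqxx uv_neq mul1n mul0n. Qed.

Lemma mdeg_uvmon a b : mdeg (uvmon a b) = (a + b)%N.
Proof. by rewrite mdegD !mdegMn !mdeg1 !mul1n. Qed.

Lemma uvmonD a b a' b' : (uvmon a b + uvmon a' b')%MM = uvmon (a + a') (b + b').
Proof. by apply/mnmP => i; rewrite !mnmDE !mulmnE !mulnDr; ring. Qed.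

Lemma xuvmon_xvar l i : xuvmon l (lshift 2 i) = (inord l == i).
Proof.
by rewrite /xuvmon mnmDE uvmon_xvar addn0 mnm1E (inj_eq (@lshift_inj _ _)).
Qed.

Lemma mdeg_xuvmon (i : 'I_n.+1) : mdeg (xuvmon i) = (d + 2)%N.
Proof.
by rewrite mdegD mdeg1 mdeg_uvmon /d; have := ltn_ord i; lia.
Qed.

Lemma exceptional_formE : f = \sum_(i < n.+1) 'X_[xuvmon i]
  + \sum_k linear_form (pad (row k L)) ^+ (d + 2).
Proof.
congr (_ + _).
  apply: eq_bigr => i _; rewrite /xuvmon /uvmon !mpolyXD -!mpolyXn mulrA.
  by rewrite /xvar inord_val -mul2n.
apply: eq_bigr => k _; congr (_ ^+ _).
rewrite /linform /linear_form big_split_ord /= [X in _ = _ + X]big1 ?addr0 => [|i _].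
  by apply: eq_bigr => i _; rewrite pad_lshift.
by rewrite pad_rshift scale0r.
Qed.

Local Notation pairing := (apolar_pairing (d + 2) f).
Definition kappa i : C := (multinomial C (xuvmon i))^-1.

Lemma kappa_neq0 i : kappa i != 0.
Proof. by rewrite invr_eq0 multinomial_neq0. Qed.

Lemma pairingE p : p \is (d + 2).-homog -> pairing p =
  \sum_(i < n.+1) p@_(xuvmon i) * kappa i + \sum_k p.@[pad (row k L)].
Proof.
by move=> homp; rewrite exceptional_formE apolar_pairingE //; apply: mdeg_xuvmon.
Qed.

(** The first part of f is linear in the x-variables, so only h contributes. *)
Lemma pairing_xx i j p : p \is d.-homog ->
  pairing ('X_(lshift 2 i) * 'X_(lshift 2 j) * p)
  = \sum_k L k i * L k j * p.@[pad (row k L)].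
Proof.
move=> homp; rewrite pairingE; last first.
  by rewrite (addnC d 2); apply: dhomogM homp; rewrite -mpolyXD dhomogX /= mdegD !mdeg1.
rewrite big1 ?add0r => [|l _].
  by apply: eq_bigr => k _; rewrite !mevalM !mevalXU !pad_lshift !mxE.
rewrite [_ * p]mulrC -mpolyXD mcoeffMX_eq0 ?mul0r //.
apply/negP => /mnm_lepP le_m; have := le_m (lshift 2 j); have := le_m (lshift 2 i).
rewrite !xuvmon_xvar !mnmDE !mnm1E !eqxx !(inj_eq (@lshift_inj _ _)).
rewrite (eq_sym j i); have [->|ne_ij] := eqVneq i j; first by case: eqP.
by case: eqP => //= -> _; rewrite (negPf ne_ij).
Qed.

(** The products x_i v and x_i u, interleaved so that the [k]-th one contracts the first part of f
    to a multiple of u^(d-k) v^k. *)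
Definition zpoly k : {mpoly C[n.+1 + 2]} :=
  'X_(xvar k./2) * 'X_(if odd k then uvar else vvar).

Lemma zpoly_homog k : zpoly k \is 2.-homog.
Proof. by rewrite /zpoly -mpolyXD dhomogX /= mdegD !mdeg1. Qed.

Lemma meval_zpoly k c : (zpoly k).@[pad c] = 0.
Proof. by rewrite /zpoly mevalM !mevalXU; case: odd; rewrite pad_rshift mulr0. Qed.

Lemma pairing_z k p : (k <= d)%N -> p \is d.-homog ->
  pairing (zpoly k * p) = kappa k./2 * p@_(uvmon (d - k) k).
Proof.
move=> le_kd homp; rewrite pairingE; last by rewrite (addnC d 2); apply/dhomogM/homp/zpoly_homog.
rewrite [X in _ + X]big1 ?addr0 => [|l _]; last by rewrite mevalM meval_zpoly mul0r.
have lt_k2 : (k./2 < n.+1)%N by move: le_kd; rewrite /d; lia.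
rewrite (bigD1 (Ordinal lt_k2)) //= big1 ?addr0 => [|i ne_ik].
  rewrite mulrC; congr (_ * _); rewrite [_ * p]mulrC /zpoly -mpolyXD.
  suff -> : xuvmon k./2 = (U_(xvar k./2) + U_(if odd k then uvar else vvar)
      + uvmon (d - k) k)%MM by apply: mcoeffMX.
  rewrite /xuvmon -addmA; congr (_ + _)%MM.
  have -> : U_(if odd k then uvar else vvar)%MM = uvmon (odd k) (~~ odd k).
    by rewrite /uvmon; case: odd; rewrite /= mulm0n mulm1n ?addm0 ?add0m.
  by rewrite uvmonD; congr uvmon; move: le_kd; rewrite /d; lia.
rewrite [_ * p]mulrC /zpoly -mpolyXD mcoeffMX_eq0 ?mul0r //.
apply/negP => /mnm_lepP/(_ (xvar k./2)); rewrite xuvmon_xvar !mnmDE mnm1E eqxx.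
suff -> : (inord i == inord k./2 :> 'I_n.+1) = false by [].
apply: contraNF ne_ik => /eqP; rewrite inord_val => ->.
by apply/eqP/val_inj; rewrite /= inordK.
Qed.

Lemma meval_uvmon a b c : (0 < a + b)%N -> ('X_[uvmon a b]).@[pad c] = 0.
Proof.
move=> ab; rewrite /uvmon mpolyXD -!mpolyXn mevalM !rmorphXn /= !mevalXU.
by rewrite !pad_rshift -exprD expr0n gtn_eqF.
Qed.

Lemma pairing_uvmon a b : (a + b = d + 2)%N -> pairing 'X_[uvmon a b] = 0.
Proof.
move=> ab; rewrite pairingE ?dhomogX /= ?mdeg_uvmon ?ab //.
rewrite !big1 ?addr0 // => [l _|i _]; first by rewrite meval_uvmon // ab addnS.
rewrite mcoeffX; case: eqP => [eq_m|_]; last by rewrite mul0r.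
have := xuvmon_xvar i i; rewrite -eq_m uvmon_xvar inord_val eqxx //.
Qed.

Lemma exceptional_form_homog : f \is (d + 2).-homog.
Proof.
rewrite exceptional_formE; apply: rpredD; apply: rpred_sum => i _.
  by rewrite dhomogX /= mdeg_xuvmon.
by have := dhomogMn (d + 2) (linear_form_homog (pad (row i L))); rewrite mul1n.
Qed.

Lemma fcoef_exceptional_form_neq0 : fcoef (d + 2) f != 0.
Proof.
have [k kE] := mexp_surj (mdeg_xuvmon ord0).
apply/eqP => /rowP/(_ k); rewrite fcoefE kE mxE; apply/eqP.
rewrite exceptional_formE mcoeffD !raddf_sum (bigD1 ord0) //= mcoeffX eqxx.
rewrite !big1 ?addr0 ?oner_eq0 // => [j _|i ne_i0].
  rewrite (mcoeff_linear_form_exp _ (mdeg_xuvmon ord0)).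
  suff -> : mmap1 (pad (row j L)) (xuvmon 0) = 0 by rewrite mulr0.
  transitivity ('X_[xuvmon 0]).@[pad (row j L)]; first by rewrite mevalX.
  by rewrite /xuvmon mpolyXD mevalM meval_uvmon ?mulr0.
rewrite mcoeffX; case: eqP => // eq_m.
have := xuvmon_xvar 0 i; rewrite -eq_m xuvmon_xvar inord_val eqxx.
case: eqP => // eq_0i; case/eqP: ne_i0; rewrite -eq_0i.
by apply/val_inj; rewrite /= inordK.
Qed.

Lemma exceptional_form_neq0 : f != 0.
Proof.
apply: contraNneq fcoef_exceptional_form_neq0 => ->.
by apply/eqP/rowP => k; rewrite !mxE mcoeff0.
Qed.

(** * Quadrics dual to the linear forms *)

Section Core.
Variable W : 'I_('C(n.+2, 2)) -> 'I_n.+1 -> 'I_n.+1 -> C.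
Hypothesis WL : forall k l, \sum_i \sum_j W k i j * (L l i * L l j) = (k == l)%:R.

(** By [WL], a Lagrange basis at the coefficient vectors of the linear forms. *)
Definition quadric k : {mpoly C[n.+1 + 2]} :=
  \sum_i \sum_j W k i j *: ('X_(lshift 2 i) * 'X_(lshift 2 j)).

Lemma meval_quadric k l : (quadric k).@[pad (row l L)] = (k == l)%:R.
Proof.
rewrite -WL raddf_sum; apply: eq_bigr => i _ /=; rewrite raddf_sum.
by apply: eq_bigr => j _ /=; rewrite mevalZ mevalM !mevalXU !pad_lshift !mxE.
Qed.

Lemma quadric_homog k : quadric k \is 2.-homog.
Proof.
apply: rpred_sum => i _; apply: rpred_sum => j _; apply: rpredZ.
by rewrite -mpolyXD dhomogX /= mdegD !mdeg1.
Qed.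

Lemma pairing_quadric k p : p \is d.-homog ->
  pairing (quadric k * p) = p.@[pad (row k L)].
Proof.
move=> homp.
transitivity (\sum_l \sum_i \sum_j
    W k i j * (L l i * L l j) * p.@[pad (row l L)]).
  rewrite [RHS]exchange_big mulr_suml linear_sum; apply: eq_bigr => i _ /=.
  rewrite [RHS]exchange_big mulr_suml linear_sum; apply: eq_bigr => j _ /=.
  rewrite -scalerAl linearZ /= pairing_xx // mulr_sumr.
  by apply: eq_bigr => l _; apply: mulrA.
under eq_bigr => l _ do (under eq_bigr do rewrite -mulr_suml; rewrite -mulr_suml WL).
rewrite (bigD1 k) //= eqxx mul1r big1 ?addr0 // => l ne_lk.
by rewrite eq_sym (negPf ne_lk) mul0r.
Qed.

Lemma row_neq0 k : exists j, L k j != 0.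
Proof.
apply/existsP; apply: contraT; rewrite negb_exists => /forallP L0.
have := WL k k; rewrite eqxx big1 => [/eqP|i _]; first by rewrite eq_sym oner_eq0.
by rewrite big1 // => j _; rewrite (eqP (negbNE (L0 i))) mul0r mulr0.
Qed.

(** * Upper bound for the border rank *)

Section BorderRank.
Variable z : C.
Hypothesis zP : (d + 4).-primitive_root z.

Definition node (j : nat) : {mpoly C[n.+1 + 2]} := 'X_uvar + z ^+ j *: 'X_vvar.

(* The coefficients invert a discrete Fourier transform: they extract         *)
(* [u ^+ (d - 2 i) * v ^+ (2 i).+1] from the powers [node j ^+ d.+1].         *)
Definition tangent (j : nat) : {mpoly C[n.+1 + 2]} := \sum_(i < n.+1)
  (z ^+ (j * (d + 4 - i.*2.+2)) / ((d + 2) * (d + 4) * 'C(d.+1, i.*2.+1))%:R)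
    *: 'X_(xvar i).

Lemma node_moment k E : \sum_(j < d + 4) z ^+ (j * k) *: node j ^+ E
  = \sum_(b < E.+1) (if (d + 4 %| k + b)%N then (d + 4)%:R else 0)
      *: ('X_[uvmon (E - b) b] *+ 'C(E, b)).
Proof.
transitivity (\sum_(j < d + 4) \sum_(b < E.+1)
    z ^+ (j * (k + b)) *: ('X_[C, uvmon (E - b) b] *+ 'C(E, b))).
  apply: eq_bigr => j _; rewrite exprDn scaler_sumr; apply: eq_bigr => b _.
  rewrite exprZn -scalerAr scalerMnr scalerA -exprM -exprD -mulnDr.
  by rewrite -scalerMnr -scalerMnr !mpolyXn -mpolyXD.
rewrite exchange_big; apply: eq_bigr => b _ /=.
by rewrite -scaler_suml (sum_prim_root _ zP).
Qed.

Lemma node_relation : \sum_(j < d + 4) z ^+ j *: node j ^+ (d + 2) = 0.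
Proof.
under eq_bigr => j _ do rewrite -[X in z ^+ X]muln1.
(* Here 0 < 1 + b < d + 4, so every term of the transform vanishes. *)
rewrite node_moment big1 // => b _; rewrite gtnNdvd ?scale0r //.
by have := ltn_ord b; lia.
Qed.

Lemma tangent_limit :
  \sum_(j < d + 4) z ^+ j *: ((node j ^+ (d + 2 - 1) * tangent j) *+ 'C(d + 2, 1))
  = \sum_(i < n.+1) 'X_[xuvmon i].
Proof.
transitivity (\sum_(i < n.+1) ((d + 4) * 'C(d.+1, i.*2.+1))%:R^-1 *:
    ('X_(xvar i) * \sum_(j < d + 4) z ^+ (j * (1 + (d + 4 - i.*2.+2))) *: node j ^+ d.+1)).
  under eq_bigr do rewrite mulr_sumr -sumrMnl scaler_sumr.
  rewrite exchange_big; apply: eq_bigr => i _ /=.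
  rewrite mulr_sumr scaler_sumr; apply: eq_bigr => j _.
  rewrite -!scalerAr scalerMnl !scalerA [(j * (1 + _))%N]mulnDr muln1 exprD.
  rewrite [node _ ^+ _ * _]mulrC.
  rewrite (_ : d + 2 - 1 = d.+1)%N; last by lia.
  congr (_ *: _); rewrite bin1 -mulnA natrM -mulr_natr.
  have : (d + 2)%:R != 0 :> C by rewrite pnatr_eq0 addn2.
  have : ((d + 4) * 'C(d.+1, i.*2.+1))%:R != 0 :> C.
    rewrite pnatr_eq0 muln_eq0 addn4 /= -lt0n bin_gt0 /d.
    by have := ltn_ord i; lia.
  move: (_%:R) (_%:R) => p q p0 q0; field; exact/andP.
apply: eq_bigr => i _; have lt_in := ltn_ord i.
have lt_id : (i.*2.+1 < d.+2)%N by rewrite /d; lia.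
(* As b is at most d + 1, only b = 2 i + 1 makes the exponent a multiple of d + 4. *)
rewrite node_moment (bigD1 (Ordinal lt_id)) //= big1 ?addr0 => [|b ne_bi].
  rewrite (_ : 1 + _ + _ = d + 4)%N; last by rewrite /d; lia.
  rewrite dvdnn -scaler_nat scalerA -scalerAr scalerA -natrM mulVf ?scale1r.
    by rewrite /xuvmon mpolyXD (_ : d.+1 - i.*2.+1 = d - i.*2)%N ?subSS.
  rewrite pnatr_eq0 muln_eq0 addn4 /= -lt0n bin_gt0.
  by rewrite /d; lia.
case: ifP => [|_]; last by rewrite scale0r.
case/dvdnP => k kE; case/eqP: ne_bi; apply/val_inj => /=.
have := ltn_ord b; move: kE lt_in; rewrite /d; case: k => [|[|k]]; lia.
Qed.

Lemma node_linear t j : node j + t *: tangent j \is 1.-homog.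
Proof.
have homX i : 'X_i \is [in C[n.+1 + 2], 1.-homog] by rewrite dhomogX /= mdeg1.
apply: rpredD; first by apply/rpredD/rpredZ.
by apply/rpredZ/rpred_sum => i _; apply: rpredZ.
Qed.

Lemma node_neq0 t j : node j + t *: tangent j != 0.
Proof.
apply/eqP => /(congr1 (mcoeff U_(uvar)%MM)); rewrite mcoeff0 !mcoeffD !mcoeffZ.
rewrite !mcoeffXU eqxx eq_sym uv_neq mulr0 addr0 raddf_sum /= big1 ?mulr0 ?addr0.
  by apply/eqP; rewrite oner_eq0.
by move=> i _; rewrite mcoeffZ mcoeffXU /xvar /uvar eq_lrshift mulr0.
Qed.

Lemma exceptional_form_in_secant : in_secant (d + 2) f ('C(n.+2, 2) + d + 4).
Proof.
pose F' a := \sum_(j < d + 4) z ^+ j *: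
  ((node j ^+ (d + 2 - a.+1) * tangent j ^+ a.+1) *+ 'C(d + 2, a.+1)).
pose F a := if a is 0 then f else F' a.
have card_index : (#|{: 'I_('C(n.+2, 2)) + 'I_(d + 4)}| = 'C(n.+2, 2) + d + 4)%N.
  by rewrite card_sum !card_ord addnA.
rewrite -card_index.
(* The curve has the d + 2 coefficients of [tangent_family], and n.*2 + 2 = d + 1 is the last
   exponent; h joins the constant term only. *)
apply: (@in_secant_limit _ _ _ _ (n.*2 + 2) F); first exact: fcoef_exceptional_form_neq0.
move=> t t0.
pose l (i : 'I_('C(n.+2, 2)) + 'I_(d + 4)) := match i with
  | inl k => linear_form (pad (row k L)) | inr j => node j + t *: tangent j end.
pose c (i : 'I_('C(n.+2, 2)) + 'I_(d + 4)) :=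
  match i with inl k => 1 | inr j => z ^+ j / t end.
have FE k : \sum_(a < k.+1) t ^+ a *: F a
    = \sum_i linear_form (pad (row i L)) ^+ (d + 2) + \sum_(a < k.+1) t ^+ a *: F' a.
  rewrite !big_ord_recl !expr0 !scale1r /= exceptional_formE.
  have -> : F' 0%N = \sum_(i < n.+1) 'X_[xuvmon i] by rewrite -tangent_limit.
  by rewrite [RHS]addrCA addrA.
rewrite FE (_ : _ + _ = \sum_i c i *: l i ^+ (d + 2)); last first.
  rewrite big_sumType /= (tangent_family _ node_relation) //.
  by under [in RHS]eq_bigr do rewrite scale1r.
apply: secant_union_powers => -[k|j] /=;
  [exact: linear_form_homog | exact: node_linear | | exact: node_neq0].
have [i Li] := row_neq0 k; apply: contraNneq Li => /(congr1 (mcoeff U_(lshift 2 i)%MM)).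
by rewrite mcoeff_linear_form pad_lshift mxE mcoeff0 => ->.
Qed.
End BorderRank.

(** * The catalecticant in degree 3 *)

Hypothesis n_gt1 : (1 < n)%N.

Definition pivot k := xchoose (row_neq0 k).

Lemma pivot_neq0 k : L k (pivot k) != 0.
Proof. exact: (xchooseP (row_neq0 k)). Qed.

(** The blocks are cubics detecting the points of h, cubics linear in the x-variables, and binary
    cubics in u and v. *)
Definition cubic_index := ('I_('C(n.+2, 2)) + 'I_d + 'I_4)%type.

(* Dual bases, up to the apolar ideal of f, of the dual forms of degrees 3    *)
(* and d - 1.                                                                 *)
Definition dual_cubic (j : cubic_index) : {mpoly C[n.+1 + 2]} :=
  match j with
  | inl (inl k) => (L k (pivot k) ^- (d - 2)) *: (quadric k * 'X_(lshift 2 (pivot k)))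
  | inl (inr k) => (kappa k./2)^-1 *: (zpoly k * 'X_uvar)
  | inr k => 'X_[uvmon (3 - k) k]
  end.

Definition dual_form (j : cubic_index) : {mpoly C[n.+1 + 2]} :=
  match j with
  | inl (inl k) => quadric k * 'X_(lshift 2 (pivot k)) ^+ (d - 3)
  | inl (inr k) => 'X_[uvmon (d - k.+1) k]
  | inr k => (kappa k./2)^-1 *: (zpoly k * 'X_uvar ^+ (d - 3))
  end.

Let d_gt4 : (4 < d)%N.
Proof. by rewrite /d; lia. Qed.

Lemma dual_cubic_homog j : dual_cubic j \is 3.-homog.
Proof.
case: j => [[k|k]|k] /=.
- by apply/rpredZ/(dhomogM (d := 2) (e := 1)); rewrite ?quadric_homog // dhomogX /= mdeg1.
- by apply/rpredZ/(dhomogM (d := 2) (e := 1)); rewrite ?zpoly_homog // dhomogX /= mdeg1.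
- by rewrite dhomogX /= mdeg_uvmon subnK // -ltnS.
Qed.

Let linX_homog i : 'X_i ^+ (d - 3) \is [in C[n.+1 + 2], (d - 3).-homog].
Proof. by rewrite mpolyXn dhomogX /= mdegMn mdeg1 mul1n. Qed.

Lemma dual_form_homog j : dual_form j \is (d - 1).-homog.
Proof.
have dE : (d - 1 = 2 + (d - 3))%N by rewrite /d; lia.
case: j => [[k|k]|k] /=.
- by rewrite dE; apply/dhomogM/linX_homog/quadric_homog.
- by rewrite dhomogX /= mdeg_uvmon; have := ltn_ord k; rewrite /d; lia.
- by rewrite dE; apply/rpredZ/dhomogM/linX_homog/zpoly_homog.
Qed.

Let linM_homog i p : p \is (d - 1).-homog -> 'X_i * p \is [in C[n.+1 + 2], d.-homog].
Proof.
move=> homp; have := dhomogM (_ : 'X_i \is [in C[n.+1 + 2], 1.-homog]) homp.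
by rewrite add1n subn1 /=; apply; rewrite dhomogX /= mdeg1.
Qed.

Let cubicM_homog i j : 'X_i ^+ (d - 3) * dual_cubic j \is d.-homog.
Proof.
have := dhomogM (linX_homog i) (dual_cubic_homog j).
by rewrite subnK // (leq_trans _ d_gt4).
Qed.

Lemma uvmon_eq a b a' b' : (a + b = a' + b')%N ->
  (uvmon a b == uvmon a' b') = (b == b').
Proof.
move=> ab; apply/eqP/eqP => [/(congr1 (fun m : 'X_{1..n.+1 + 2} => m vvar))|eqb].
  by rewrite !uvmon_v.
by congr uvmon => //; move: ab; rewrite eqb => /addIn.
Qed.

Lemma mcoeff_zpolyM_uvmon k p a b : (zpoly k * p)@_(uvmon a b) = 0.
Proof.
rewrite mulrC /zpoly -mpolyXD mcoeffMX_eq0 //.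
apply/negP => /mnm_lepP/(_ (xvar k./2)).
by rewrite uvmon_xvar mnmDE mnm1E eqxx.
Qed.

Lemma pairing_zu k p : (k < d)%N -> p \is (d - 1).-homog ->
  pairing (zpoly k * 'X_uvar * p) = kappa k./2 * p@_(uvmon (d - k.+1) k).
Proof.
move=> lt_kd homp; rewrite -mulrA pairing_z ?linM_homog 1?ltnW //.
congr (_ * _); rewrite mulrC.
suff -> : uvmon (d - k) k = (U_(uvar) + uvmon (d - k.+1) k)%MM by apply: mcoeffMX.
have -> : U_(uvar)%MM = uvmon 1 0 by rewrite /uvmon mulm1n mulm0n addm0.
by rewrite uvmonD; congr uvmon; lia.
Qed.

(** Pairing with a multiple of a quadric evaluates at a point with u = v = 0, which kills the other
    blocks; the remaining pairings read a single coefficient of a binary form. *)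
Lemma pairing_dual j k : pairing (dual_cubic j * dual_form k) = (j == k)%:R.
Proof.
have homk := dual_form_homog k; case: j => [[j|j]|j].
- rewrite -scalerAl linearZ /= -[quadric j * _ * _]mulrA pairing_quadric ?linM_homog //.
  rewrite mevalM mevalXU.
  rewrite pad_lshift mxE; case: k homk => [[k|k]|k] homk /=.
  + rewrite mevalM rmorphXn /= meval_quadric mevalXU pad_lshift mxE.
    rewrite -[inl _ == _]/(j == k) eq_sym; case: eqP => [->|_]; last first.
      by rewrite mul0r !mulr0.
    rewrite mul1r -exprS (_ : (d - 3).+1 = (d - 2)%N); last by rewrite /d; lia.
    by rewrite mulVf // expf_neq0 // pivot_neq0.
  + by rewrite meval_uvmon ?mulr0 //; have := ltn_ord k; lia.
  + by rewrite mevalZ mevalM meval_zpoly mul0r !mulr0.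
- case: k homk => [[k|k]|k] homk.
  + rewrite [dual_form _]/= mulrC -mulrA pairing_quadric ?cubicM_homog //.
    by rewrite /= mevalM mevalZ mevalM meval_zpoly mul0r !mulr0.
  + rewrite -scalerAl linearZ /= pairing_zu // mcoeffX uvmon_eq; last first.
      by have := ltn_ord j; have := ltn_ord k; lia.
    by rewrite mulrA mulVf ?kappa_neq0 // mul1r eq_sym.
  + rewrite -scalerAl linearZ /= pairing_zu // mcoeffZ mcoeff_zpolyM_uvmon.
    by rewrite !mulr0.
- case: k homk => [[k|k]|k] homk.
  + rewrite [dual_form _]/= mulrC -mulrA pairing_quadric ?cubicM_homog //.
    by rewrite /= mevalM meval_uvmon ?mulr0 //; have := ltn_ord j; lia.
  + rewrite /= -mpolyXD uvmonD pairing_uvmon //.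
    by have := ltn_ord j; have := ltn_ord k; lia.
  + rewrite /= -scalerAr linearZ /= ['X_[uvmon _ _] * _]mulrC
      -[zpoly k * _ * _]mulrA pairing_z; last 2 first.
    * by have := ltn_ord k; lia.
    * exact: cubicM_homog _ (inr j).
    have -> : 'X_uvar ^+ (d - 3) = 'X_[uvmon (d - 3) 0] :> {mpoly C[n.+1 + 2]}.
      by rewrite mpolyXn /uvmon mulm0n addm0.
    rewrite -mpolyXD uvmonD mcoeffX uvmon_eq; last first.
      by have := ltn_ord j; have := ltn_ord k; lia.
    by rewrite add0n mulrA mulVf ?kappa_neq0 // mul1r.
Qed.

(** * Schemes of small length *)

Section SmallScheme.
Variables (A : comAlgType C) (s : nat) (e : 'I_s -> A).
Hypothesis eP : free_basis e.
Hypothesis s_small : (s <= 'C(n.+2, 2) + d + 4)%N.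
Variables (x : 'I_(n.+1 + 2) -> C) (a : 'I_(n.+1 + 2) -> A) (psi : {scalar A}).
Hypothesis xa1 : \sum_i x i *: a i = 1.
Local Notation ev := (mmap (in_alg A) a).
Hypothesis psiE : forall p, p \is (d + 2).-homog -> psi (ev p) = pairing p.

Let evX i : ev 'X_i = a i.
Proof. by rewrite mmapX mmap1U. Qed.

(* The scheme has length at most the rank of the catalecticant in degree 3,   *)
(* so its ideal agrees in that degree with the apolar ideal.                  *)
Lemma ev_eq0 p : p \is 3.-homog ->
  (forall q, q \is (d - 1).-homog -> pairing (p * q) = 0) -> ev p = 0.
Proof.
move=> homp p0.
have hom3 q r : q \is 3.-homog -> r \is (d - 1).-homog -> q * r \is (d + 2).-homog.
  by move=> homq homr; have := dhomogM homq homr; rewrite (_ : 3 + (d - 1) = d + 2)%N;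
    [|rewrite /d; lia].
have Psi_lin k : scalar (fun b => psi (b * ev (dual_form k))).
  by move=> c y z; rewrite mulrDl -scalerAl linearP.
pose Psi k := HB.pack_for {scalar A} (fun b => psi (b * ev (dual_form k)))
  (GRing.isLinear.Build _ _ _ _ (fun b => psi (b * ev (dual_form k))) (Psi_lin k)).
apply: (dual_family_separates eP (E := fun j => ev (dual_cubic j)) (Psi := Psi)).
- move=> j k; rewrite /= -rmorphM psiE ?pairing_dual //.
  exact/hom3/dual_form_homog/dual_cubic_homog.
- by rewrite !card_sum !card_ord.
- move=> k; rewrite /= -rmorphM psiE ?p0 ?dual_form_homog //.
  exact/hom3/dual_form_homog.
Qed.

Let linear3_homog p i : p \is 2.-homog -> p * 'X_i \is [in C[n.+1 + 2], 3.-homog].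
Proof.
move=> homp; have := dhomogM homp (_ : 'X_i \is [in C[n.+1 + 2], 1.-homog]).
by apply; rewrite dhomogX /= mdeg1.
Qed.

Lemma ev_xx i j (l : 'I_2) : a (lshift 2 i) * a (lshift 2 j) * a (rshift n.+1 l) = 0.
Proof.
rewrite -!evX -!rmorphM; apply: ev_eq0 => [|q homq].
  by apply: linear3_homog; rewrite -mpolyXD dhomogX /= mdegD !mdeg1.
rewrite -mulrA pairing_xx ?linM_homog // big1 // => k _.
by rewrite mevalM mevalXU pad_rshift mul0r mulr0.
Qed.

Definition zelt k : A := (kappa k./2)^-1 *: ev (zpoly k).

Lemma pairing_zMX k i q : (k <= d)%N -> q \is (d - 1).-homog ->
  pairing (((kappa k./2)^-1 *: zpoly k) * 'X_i * q) = (q * 'X_i)@_(uvmon (d - k) k).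
Proof.
move=> le_kd homq; rewrite -mulrA -scalerAl linearZ /= pairing_z ?linM_homog //.
by rewrite mulrA mulVf ?kappa_neq0 // mul1r mulrC.
Qed.

Lemma zelt_evX k i :
  zelt k * a i = ev (((kappa k./2)^-1 *: zpoly k) * 'X_i).
Proof. by rewrite rmorphM /= mmapZ evX mulr_algl. Qed.

(** Both sides come from cubics whose pairing with a form of degree d - 1 reads its coefficient at
    u^(d-1-k) v^k. *)
Lemma zelt_shift k : (k < d)%N -> zelt k * a uvar = zelt k.+1 * a vvar.
Proof.
move=> lt_kd; apply/eqP; rewrite -subr_eq0 !zelt_evX -rmorphB; apply/eqP.
apply: ev_eq0 => [|q homq].
  by apply: rpredB; apply: linear3_homog; apply/rpredZ/zpoly_homog.
rewrite mulrBl linearB /= (pairing_zMX uvar (ltnW lt_kd) homq).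
rewrite (pairing_zMX vvar lt_kd homq).
have -> : uvmon (d - k) k = (U_(uvar) + uvmon (d - k.+1) k)%MM.
  have -> : U_(uvar)%MM = uvmon 1 0 by rewrite /uvmon mulm1n mulm0n addm0.
  by rewrite uvmonD; congr uvmon; lia.
have -> : uvmon (d - k.+1) k.+1 = (U_(vvar) + uvmon (d - k.+1) k)%MM.
  have -> : U_(vvar)%MM = uvmon 0 1 by rewrite /uvmon mulm1n mulm0n add0m.
  by rewrite uvmonD.
by rewrite !mcoeffMX subrr.
Qed.

Lemma zelt_last : zelt d * a uvar = 0.
Proof.
rewrite zelt_evX; apply: ev_eq0 => [|q homq]; first by apply/linear3_homog/rpredZ/zpoly_homog.
rewrite pairing_zMX // subnn mcoeffMX_eq0 //.
by apply/negP => /mnm_lepP/(_ uvar); rewrite mnm1E eqxx uvmon_u.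
Qed.

Lemma zelt_first : zelt 0 * a vvar = 0.
Proof.
rewrite zelt_evX; apply: ev_eq0 => [|q homq]; first by apply/linear3_homog/rpredZ/zpoly_homog.
rewrite pairing_zMX // mcoeffMX_eq0 //.
by apply/negP => /mnm_lepP/(_ vvar); rewrite mnm1E eqxx uvmon_v.
Qed.

(** Multiply by the unit of [xa1]: its x-part acts as zero by [ev_xx]. *)
Lemma zeltE k : zelt k = x uvar *: (zelt k * a uvar) + x vvar *: (zelt k * a vvar).
Proof.
rewrite -{1}[zelt k]mulr1 -xa1 big_split_ord mulrDr /= mulr_sumr big1 ?add0r => [|i _].
  rewrite mulr_sumr big_ord_recl big_ord1 -!scalerAr.
  by rewrite /vvar (_ : ord_max = lift ord0 ord0) //; apply: val_inj.
rewrite -scalerAr /zelt -scalerAl rmorphM /= !evX mulrAC.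
by case: odd; rewrite ev_xx !scaler0.
Qed.

Lemma psi_zelt k l : (k <= d)%N -> (l <= d)%N ->
  psi (zelt k * ev 'X_[uvmon (d - l) l]) = (k == l)%:R.
Proof.
move=> le_kd le_ld; have hom : 'X_[uvmon (d - l) l] \is [in C[n.+1 + 2], d.-homog].
  by rewrite dhomogX /= mdeg_uvmon subnK.
rewrite -scalerAl linearZ /= -rmorphM psiE; last first.
  by rewrite (addnC d 2); apply/dhomogM/hom/zpoly_homog.
rewrite pairing_z // mulrA mulVf ?kappa_neq0 // mul1r mcoeffX uvmon_eq ?subnK //.
by rewrite eq_sym.
Qed.

(* The relations above make multiplication by the unit [\sum_i x i *: a i]    *)
(* kill a nontrivial combination of the independent elements [zelt k].        *)
Lemma small_scheme_contradiction : False.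
Proof.
(* Chosen so that c k * x_u + c k.+1 * x_v = 0, which makes the sum telescope by [zelt_shift]. *)
pose c k := (- x uvar) ^+ k * x vvar ^+ (d - k).
have dep : \sum_(k < d.+1) c k *: zelt k = 0.
  under eq_bigr do rewrite zeltE scalerDr !scalerA.
  rewrite big_split big_ord_recr /= zelt_last scaler0 addr0.
  rewrite [X in _ + X]big_ord_recl /= zelt_first scaler0 add0r -big_split /=.
  apply: big1 => k _; rewrite zelt_shift // -scalerDl.
  suff -> : c k * x uvar + c k.+1 * x vvar = 0 by rewrite scale0r.
  rewrite /c exprS (_ : d - k = (d - k.+1).+1)%N ?exprS; last by have := ltn_ord k; lia.
  ring.
have c0 l : (l <= d)%N -> c l = 0.
  move=> le_ld; have := congr1 (fun y => psi (y * ev 'X_[uvmon (d - l) l])) dep.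
  rewrite mul0r linear0 mulr_suml linear_sum /= => <-.
  rewrite (bigD1 (Ordinal (le_ld : (l < d.+1)%N))) //= big1 ?addr0 => [|k ne_kl].
    by rewrite -scalerAl linearZ /= psi_zelt // eqxx mulr1.
  rewrite -scalerAl linearZ /= psi_zelt //; last by rewrite -ltnS.
  rewrite (_ : (k == l :> nat) = false) ?mulr0 //.
  by apply: contraNF ne_kl => /eqP kl; apply/eqP/val_inj.
(* The extreme coefficients are powers of x_v and -x_u, so both vanish, and then [zeltE] kills
   [zelt 0]. *)
have xv0 : x vvar = 0.
  have := c0 0%N isT; rewrite /c expr0 mul1r subn0 => /eqP.
  by rewrite expf_eq0 => /andP[_ /eqP].
have xu0 : x uvar = 0.
  have := c0 d (leqnn d); rewrite /c subnn mulr1 => /eqP.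
  by rewrite expf_eq0 oppr_eq0 => /andP[_ /eqP].
have z0 : zelt 0 = 0 by rewrite zeltE xv0 xu0 !scale0r addr0.
have := psi_zelt (leq0n d) (leq0n d); rewrite z0 mul0r linear0 eqxx.
by move/eqP; rewrite eq_sym oner_eq0.
Qed.
End SmallScheme.
Lemma smoothable_span_gt s : in_smoothable_span (d + 2) f s ->
  ('C(n.+2, 2) + d + 4 < s)%N.
Proof.
case=> K [KV [e eP] _ fK]; rewrite ltnNge; apply/negP => s_small.
have [|x [a [psi [xa1 psiE]]]] := apolarity KV fK; first by rewrite addn2.
exact: (small_scheme_contradiction eP s_small xa1 psiE).
Qed.
End Core.

End ExceptionalForm.

(** * Reduced schemes spanning the space of forms *)

Section PowerAlgebra.
Variables (C : fieldType) (k : nat).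

(** The coordinate ring of k + 1 reduced points; the successor keeps it nonzero. *)
Definition power_algebra := {ffun 'I_k.+1 -> C}.

HB.instance Definition _ := GRing.PzRing.on power_algebra.
HB.instance Definition _ := GRing.PzSemiRing_isNonZero.Build power_algebra
  (@ffun1_nonzero _ C (ord0 : 'I_k.+1)).
HB.instance Definition _ := GRing.PzSemiRing_hasCommutativeMul.Build power_algebra
  (@ffun_mulC 'I_k.+1 C).

Definition power_algebra_scale (c : C) (x : power_algebra) : power_algebra :=
  [ffun i => c * x i].

Fact power_algebra_scaleA c c' x :
  power_algebra_scale c (power_algebra_scale c' x) = power_algebra_scale (c * c') x.
Proof. by apply/ffunP => i; rewrite !ffunE mulrA. Qed.

Fact power_algebra_scale1 : left_id 1 power_algebra_scale.
Proof. by move=> x; apply/ffunP => i; rewrite ffunE mul1r. Qed.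

Fact power_algebra_scaleDr : right_distributive power_algebra_scale +%R.
Proof. by move=> c x y; apply/ffunP => i; rewrite !ffunE mulrDr. Qed.

Fact power_algebra_scaleDl x :
  {morph power_algebra_scale^~ x : c c' / c + c'}.
Proof. by move=> c c'; apply/ffunP => i; rewrite !ffunE mulrDl. Qed.

HB.instance Definition _ := GRing.Zmodule_isLmodule.Build C power_algebra
  power_algebra_scaleA power_algebra_scale1 power_algebra_scaleDr power_algebra_scaleDl.

Fact power_algebra_scaleAl (c : C) (x y : power_algebra) : c *: (x * y) = c *: x * y.
Proof. by apply/ffunP => i; rewrite !ffunE mulrA. Qed.

HB.instance Definition _ := GRing.Lmodule_isLalgebra.Build C power_algebra
  power_algebra_scaleAl.
HB.instance Definition _ := GRing.Lalgebra_isComAlgebra.Build C power_algebra.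

Lemma power_algebraZE (c : C) (x : power_algebra) i : (c *: x) i = c * x i.
Proof. by rewrite ffunE. Qed.

Definition power_algebra_eval (i : 'I_k.+1) (x : power_algebra) : C := x i.

Fact power_algebra_eval_is_zmod_morphism i : zmod_morphism (power_algebra_eval i).
Proof. by move=> x y; rewrite /power_algebra_eval !ffunE. Qed.

Fact power_algebra_eval_is_monoid_morphism i : monoid_morphism (power_algebra_eval i).
Proof. by split=> [|x y]; rewrite /power_algebra_eval !ffunE. Qed.

HB.instance Definition _ i := GRing.isZmodMorphism.Build power_algebra C
  (power_algebra_eval i) (power_algebra_eval_is_zmod_morphism i).
HB.instance Definition _ i := GRing.isMonoidMorphism.Build power_algebra C
  (power_algebra_eval i) (power_algebra_eval_is_monoid_morphism i).

Definition power_algebra_delta (i : 'I_k.+1) : power_algebra := [ffun j => (j == i)%:R].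

Lemma power_algebra_sumE (c : 'I_k.+1 -> C) j :
  (\sum_i c i *: power_algebra_delta i) j = c j.
Proof.
rewrite sum_ffunE (bigD1 j) //= power_algebraZE ffunE eqxx mulr1 big1 ?addr0 //.
by move=> i ne_ij; rewrite power_algebraZE ffunE eq_sym (negPf ne_ij) mulr0.
Qed.

Lemma power_algebra_basis : free_basis power_algebra_delta.
Proof.
exists (fun x => x) => [c|x]; apply/ffunP => j; exact: power_algebra_sumE.
Qed.
End PowerAlgebra.

(** A constant family over a point will do, its characters being the evaluations. *)
Lemma power_algebra_smoothable (C : closedFieldType) k : smoothable (power_algebra C k).
Proof.
exists C, idfun, idfun, (power_algebra C k), k.+1, (@power_algebra_delta C k), idfun.
split=> //; first exact: power_algebra_basis.
  exists C, idfun, (@power_algebra_eval C k); split=> // [i b x|].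
    by rewrite /= /power_algebra_eval power_algebraZE.
  rewrite (_ : \matrix_(i, j) _ = 1%:M) ?unitmx1 //.
  by apply/matrixP => i j; rewrite !mxE /= /power_algebra_eval ffunE.
exact: power_algebra_basis.
Qed.

Section SpanningPoints.
Variables (C : numClosedFieldType) (m D : nat).
Local Notation N := (dimR m D).

(* As long as k < N, some nonzero functional vanishes on the k powers already *)
(* chosen; it is a nonzero polynomial in the coefficients of the linear form. *)
Lemma free_veronese_points k : (k <= N)%N -> exists p : 'I_k -> 'I_m -> C,
  row_free (\matrix_i fcoef D (linear_form (p i) ^+ D)).
Proof.
elim: k => [_|k IH lt_kN].
  exists (fun _ _ => 0); rewrite -row_leq_rank leq0n //.
have [p] := IH (ltnW lt_kN); set V := \matrix_i _ => freeV.
have : cokermx V != 0.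
  by rewrite -mxrank_eq0 mxrank_coker subn_eq0 -ltnNge (eqP freeV).
case/matrix0Pn => i0 [j0 w0]; pose w := col j0 (cokermx V).
have Vw : V *m w = 0 by rewrite /w colE mulmxA mulmx_coker mul0mx.
have wi0 : w i0 0 != 0 by rewrite mxE.
pose P : {mpoly C[m]} := \sum_i (w i 0 * multinomial C (mexp i)) *: 'X_[mexp i].
have P0 : P != 0.
  apply: contraNneq wi0 => /(congr1 (mcoeff (mexp i0))); rewrite mcoeff0 raddf_sum /=.
  rewrite (bigD1 i0) //= mcoeffZ mcoeffX eqxx mulr1 big1 ?addr0 => [/eqP|i ne_i].
    by rewrite mulf_eq0 (negPf (multinomial_neq0 _ _)) orbF.
  by rewrite mcoeffZ mcoeffX (inj_eq (@mexp_inj _ _)) (negPf ne_i) mulr0.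
have [x Px] := mpoly_nonroot P0.
have PE : (fcoef D (linear_form x ^+ D) *m w) 0 0 = P.@[x].
  rewrite mxE raddf_sum; apply: eq_bigr => i _ /=.
  rewrite fcoefE (mcoeff_linear_form_exp _ (mdeg_mexp i)) mevalZ mevalX.
  by rewrite mulrC mulrA.
exists (fun i => oapp p x (unlift ord0 i)); apply: inj_row_free => u.
rewrite mulmx_sum_row big_ord_recl rowK unlift_none /= => uV.
have tailE : \sum_(i < k) u 0 (lift ord0 i) *: row (lift ord0 i)
    (\matrix_i fcoef D (linear_form (oapp p x (unlift ord0 i)) ^+ D))
  = (\row_i u 0 (lift ord0 i)) *m V.
  rewrite mulmx_sum_row; apply: eq_bigr => i _.
  by rewrite !rowK liftK mxE.
rewrite tailE in uV.
have u0 : u 0 ord0 = 0.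
  have := congr1 (fun A => (A *m w) 0 0) uV.
  rewrite mulmxDl -mulmxA Vw mulmx0 addr0 -scalemxAl mxE PE mul0mx mxE => /eqP.
  by rewrite mulf_eq0 (negPf Px) orbF => /eqP.
move: uV; rewrite u0 scale0r add0r => uV.
have /rowP u_tail : \row_i u 0 (lift ord0 i) = 0.
  by apply: (row_free_inj freeV); rewrite uV mul0mx.
apply/rowP => i; rewrite mxE; have [j ->|->//] := unliftP ord0 i.
by have := u_tail j; rewrite !mxE.
Qed.

(** As many independent Veronese points as R_D has dimensions span all of P(R_D). *)
Lemma exists_in_smoothable_span (f : {mpoly C[m]}) : (0 < D)%N -> (0 < N)%N ->
  exists s, in_smoothable_span D f s.
Proof.
move=> D_gt0 N_gt0; pose k := N.-1; have NE : k.+1 = N by rewrite /k prednK.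
have [p] : exists p : 'I_k.+1 -> 'I_m -> C,
    row_free (\matrix_i fcoef D (linear_form (p i) ^+ D)).
  by apply: free_veronese_points; rewrite NE.
set V := \matrix_i _ => freeV.
pose h j : power_algebra C k := [ffun i => V i j].
have sum_hE (lam : 'I_N -> C) i : (\sum_j lam j *: h j) i = (V *m \col_j lam j) i 0.
  rewrite sum_ffunE mxE; apply: eq_bigr => j _.
  by rewrite power_algebraZE ffunE [RHS]mulrC [X in _ = X * _]mxE.
(* Independence of the points makes every function on them linear in the coordinates, which yields
   both the chart and the closed immersion. *)
pose lift_to (y : power_algebra C k) j := (pinvmx V *m \col_i y i) j 0.
have lift_toE y : \sum_j lift_to y j *: h j = y.
  apply/ffunP => i; rewrite sum_hE (_ : \col_j _ = pinvmx V *m \col_i y i).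
    by rewrite mulmxA mulmxVp // mul1mx mxE.
  by apply/colP => j; rewrite mxE.
have fin : exists s, exists e : 'I_s -> power_algebra C k, free_basis e.
  by exists k.+1, (@power_algebra_delta C k); apply: power_algebra_basis.
have ch : exists lam : 'I_N -> C, \sum_j lam j *: h j = 1 by exists (lift_to 1).
have imm y : exists G : {mpoly C[N]}, evalA h G = y.
  exists (\sum_j lift_to y j *: 'X_j); rewrite -[RHS]lift_toE /evalA raddf_sum.
  by apply: eq_bigr => j _; rewrite /= mmapZ mmapX mmap1U mulr_algl.
exists k.+1, (FiniteSubscheme fin ch imm); split.
- move=> e G _ GV; apply/ffunP => i; rewrite [RHS]ffunE.
  have <- : evalr G (fcoef D (linear_form (p i) ^+ D)) = 0.
    apply: GV; exists (linear_form (p i)); split=> //; first exact: linear_form_homog.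
    apply/eqP => l0; have rowV0 : row i V = 0.
      by rewrite rowK l0 expr0n gtn_eqF //; apply/rowP => j; rewrite !mxE mcoeff0.
    have /matrixP/(_ 0 i) : delta_mx 0 i = 0 :> 'rV[C]_k.+1.
      by apply: (row_free_inj freeV); rewrite -rowE rowV0 mul0mx.
    by rewrite !mxE !eqxx => /eqP; rewrite oner_eq0.
  rewrite /evalA /evalr mevalE /mmap sum_ffunE; apply: eq_bigr => t _.
  rewrite mulr_algl power_algebraZE; congr (_ * _).
  rewrite -[LHS]/(power_algebra_eval i _) rmorph_prod; apply: eq_bigr => j _.
  by rewrite rmorphXn /= /power_algebra_eval ffunE mxE.
- by exists (@power_algebra_delta C k); apply: power_algebra_basis.
- exact: power_algebra_smoothable.
- move=> lam lam0; have : V *m \col_j lam j = 0.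
    by apply/colP => i; rewrite -sum_hE lam0 !ffunE mxE.
  have freeVT : row_free V^T.
    by rewrite /row_free mxrank_tr (eqP freeV) NE.
  move/(congr1 trmx); rewrite trmx_mul trmx0 => lamV.
  have /rowP lam_eq0 : (\col_j lam j)^T = 0 by apply: (row_free_inj freeVT); rewrite mul0mx.
  by apply: big1 => j _; have := lam_eq0 j; rewrite !mxE => ->; rewrite mul0r.
Qed.
End SpanningPoints.

Lemma least_witness (P : nat -> Prop) s : P s ->
  exists2 t, is_least P t & (t <= s)%N.
Proof.
move=> Ps; have exP : exists t, `[< P t >] by exists s; apply/asboolP.
case: (ex_minnP exP) => t /asboolP Pt tmin.
have tmin' u : P u -> (t <= u)%N by move=> Pu; apply/tmin/asboolP.
by exists t; [split | apply: tmin'].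
Qed.

(** * Generic linear forms *)

Section GenericLinearForms.
Variables (C : numFieldType) (n : nat).

Definition ordered_pairs := [pred p : 'I_n * 'I_n | (p.2 <= p.1)%N].

Lemma card_ordered_pairs : #|ordered_pairs| = 'C(n.+1, 2).
Proof.
rewrite -sum1_card (eq_bigl (fun p : 'I_n * 'I_n => xpredT p.1 && (p.2 <= p.1)%N)) //.
rewrite -(pair_big_dep xpredT (fun i j : 'I_n => (j <= i)%N) (fun _ _ => 1%N)) /=.
rewrite -bin2_sum big_nat_recl // big_mkord add0n; apply: eq_bigr => i _.
by rewrite -(big_ord_widen n (fun=> 1%N) (ltn_ord i)) sum1_card card_ord.
Qed.

Definition pair_of (k : 'I_('C(n.+1, 2))) : 'I_n * 'I_n :=
  enum_val (cast_ord (esym card_ordered_pairs) k).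

Lemma pair_of_inj : injective pair_of.
Proof. by move=> k l /enum_val_inj/cast_ord_inj. Qed.

Lemma pair_of_le k : ((pair_of k).2 <= (pair_of k).1)%N.
Proof. exact: (enum_valP (cast_ord (esym card_ordered_pairs) k)). Qed.

Definition quadric_values (F : comPzRingType) (L : 'I_('C(n.+1, 2)) -> 'I_n -> F) :
    'M[F]_('C(n.+1, 2)) :=
  \matrix_(k, p) (L k (pair_of p).1 * L k (pair_of p).2).

(* Evaluating quadratic monomials at the points e_i + e_j, i >= j, gives a    *)
(* triangular matrix, the pairs with i = j coming first.                      *)
Definition edge_points (k : 'I_('C(n.+1, 2))) (a : 'I_n) : C :=
  ((a == (pair_of k).1) + (a == (pair_of k).2))%:R.

Lemma quadric_values_edge_points : quadric_values edge_points \in unitmx.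
Proof.
rewrite -unitmx_tr -row_free_unit; apply: inj_row_free => w wQ.
have wE k : \sum_p w 0 p * quadric_values edge_points k p = 0.
  transitivity ((w *m (quadric_values edge_points)^T) 0 k); last by rewrite wQ mxE.
  by rewrite [RHS]mxE; apply: eq_bigr => p _; rewrite [in RHS]mxE.
have QE k p : quadric_values edge_points k p =
    ((((pair_of p).1 == (pair_of k).1) + ((pair_of p).1 == (pair_of k).2)) *
     (((pair_of p).2 == (pair_of k).1) + ((pair_of p).2 == (pair_of k).2)))%:R.
  by rewrite mxE -natrM.
have step k : (forall p, p != k -> w 0 p * quadric_values edge_points k p = 0) -> w 0 k = 0.
  move=> off; have := wE k; rewrite (bigD1 k) //= big1 ?addr0 => [/eqP|p]; last exact: off.
  rewrite mulf_eq0 QE eqxx pnatr_eq0 muln_eq0 add1n /= => /orP[/eqP //|].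
  by rewrite eqxx addnC.
(* At 2 e_a the only nonzero quadratic monomial is the square of the a-th variable; at e_a + e_b the
   mixed one remains once the squares are removed. *)
have diag k : (pair_of k).1 = (pair_of k).2 -> w 0 k = 0.
  move=> dk; apply: step => p ne_pk; rewrite QE -dk.
  case: eqP => [p1|]; last by rewrite mul0n mulr0.
  case: eqP => [p2|]; last by rewrite muln0 mulr0.
  case/eqP: ne_pk; apply: pair_of_inj.
  by rewrite [pair_of p]surjective_pairing [pair_of k]surjective_pairing p1 p2 dk.
apply/rowP => k; rewrite mxE; apply: step => p ne_pk.
have [/diag ->|ne_p] := eqVneq (pair_of p).1 (pair_of p).2; first by rewrite mul0r.
suff -> : quadric_values edge_points k p = 0 by rewrite mulr0.
apply/eqP; rewrite QE pnatr_eq0 muln_eq0; apply: contraNT ne_pk.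
have := pair_of_le p; have := pair_of_le k; move: ne_p (@pair_of_inj p k).
case: (pair_of p) (pair_of k) => p1 p2 [k1 k2] /= ne_p inj le_k le_p.
rewrite negb_or !addn_eq0 !negb_and !eqb0 !negbK.
case/andP => /orP[/eqP e1|/eqP e1] /orP[/eqP e2|/eqP e2];
  apply/eqP/inj; move: ne_p le_p le_k; rewrite ?e1 ?e2 ?eqxx //.
by move=> ne12 le12 le21; case/eqP: ne12; apply/val_inj/anti_leq; rewrite le12 le21.
Qed.

(** Its nonvanishing says that the quadrics are determined by their values at the rows of L; the
    Lagrange quadrics come from the inverse matrix. *)
Definition generic_det : {mpoly C[('C(n.+1, 2) * n)]} :=
  \det (quadric_values (fun k i => 'X_(mxvec_index k i))).

Lemma evalr_generic_det (L : 'M[C]_('C(n.+1, 2), n)) :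
  evalr generic_det (mxvec L) = \det (quadric_values (fun k => L k)).
Proof.
rewrite /evalr /generic_det -det_map_mx; congr (\det _).
by apply/matrixP => k p; rewrite !mxE /= mevalM !mevalXU !mxvecE.
Qed.

Lemma quadrics_separate (L : 'M[C]_('C(n.+1, 2), n)) :
    evalr generic_det (mxvec L) != 0 ->
  exists W : 'I_('C(n.+1, 2)) -> 'I_n -> 'I_n -> C,
    forall k l, \sum_i \sum_j W k i j * (L l i * L l j) = (k == l)%:R.
Proof.
rewrite evalr_generic_det -unitfE -unitmxE => QU.
set Q := quadric_values _ in QU.
exists (fun k i j => \sum_p ((pair_of p == (i, j))%:R * invmx Q p k)) => k l.
transitivity ((Q *m invmx Q) l k); last by rewrite mulmxV // mxE eq_sym.
rewrite [RHS]mxE.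
transitivity (\sum_p \sum_i \sum_j
    (pair_of p == (i, j))%:R * (invmx Q p k * (L l i * L l j))).
  rewrite [RHS]exchange_big; apply: eq_bigr => i _ /=.
  rewrite [RHS]exchange_big; apply: eq_bigr => j _ /=.
  by rewrite mulr_suml; apply: eq_bigr => p _; rewrite -mulrA.
apply: eq_bigr => p _; rewrite pair_bigA (bigD1 (pair_of p)) //= big1 ?addr0 => [|[i j] ne_ij].
  by rewrite -surjective_pairing eqxx mul1r mulrC mxE.
by rewrite eq_sym (negPf ne_ij) mul0r.
Qed.
End GenericLinearForms.

(** * Wildness for generic linear forms *)

Lemma exceptional_form_wild (C : numClosedFieldType) n
    (L : 'M[C]_('C(n.+2, 2), n.+1)) : (1 < n)%N ->
  evalr (generic_det C n.+1) (mxvec L) != 0 ->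
  wild (n.*2.+1 + 2) (exceptional_form n.*2.+1 L).
Proof.
move=> n_gt1 /quadrics_separate[W WL].
split; [exact: exceptional_form_homog | exact: exceptional_form_neq0 | ].
have N_gt0 : (0 < dimR (n.+1 + 2) (n.*2.+1 + 2))%N.
  have /rV0Pn[k _] := fcoef_exceptional_form_neq0 L.
  exact: leq_ltn_trans (leq0n k) (ltn_ord k).
have [z zP] := prim_root_exists C (isT : 0 < n.*2.+1 + 4)%N.
have [r r_least r_le] := least_witness (exceptional_form_in_secant WL zP).
have [s0 Ps0] := exists_in_smoothable_span (exceptional_form n.*2.+1 L)
  (isT : (0 < n.*2.+1 + 2)%N) N_gt0.
have [s s_least _] := least_witness Ps0; exists r, s; split=> //.
exact: leq_ltn_trans r_le (smoothable_span_gt WL n_gt1 s_least.1).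
Qed.

Theorem corollary3p17 (R : realType) (n d : nat)
    (d_eq : d = (2 * n - 1)%N) (d_gt3 : (3 < d)%N) :
  exists U : 'rV[R[i]]_('C(n.+1, 2) * n) -> Prop,
    [/\ zariski_open U,
        exists x, U x
      & forall L : 'M[R[i]]_('C(n.+1, 2), n),
          U (mxvec L) -> wild (d + 2) (exceptional_form d L)].
Proof.
exists (fun x => evalr (generic_det R[i] n) x <> 0); split.
- exists (fun P => P = generic_det R[i] n) => x; split=> [/contrapT x0 _ -> //|x0].
  by apply; apply: x0.
(* The edge points witness that the open set is not empty. *)
- exists (mxvec (\matrix_(k, a) @edge_points R[i] n k a)).
  rewrite evalr_generic_det (_ : quadric_values _ = quadric_values (@edge_points R[i] n)).
    by apply/eqP; rewrite -unitfE -unitmxE quadric_values_edge_points.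
  by apply/matrixP => k p; rewrite !mxE.
- move=> L /eqP; case: n d_eq L => [|n] d_eq L; first by rewrite d_eq in d_gt3.
  have dE : d = n.*2.+1 by rewrite d_eq; lia.
  by rewrite dE; apply: exceptional_form_wild; lia.
Qed.
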